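(* Let $\mathsf{V}$ be a semilinear variety of pointed residuated lattices such that for every finite set of variables $\overline{x}$, variable $y\notin\overline{x}$, $s(\overline{x},y)\in\mathrm{Tm}_{\mathcal{L}}(\overline{x},y)$ and $t(\overline{x},y)\in\mathrm{Tm}_{\mathcal{L}}(\overline{x},y)\cup\{\Lambda\}$, there exist a finite non-empty set $K$ and, for each $k\in K$, terms $s'_k(\overline{x})\in\mathrm{Tm}_{\mathcal{L}}(\overline{x})$ and $t'_k(\overline{x})\in\mathrm{Tm}_{\mathcal{L}}(\overline{x})\cup\{\Lambda\}$ such that for every finite set of variables $\overline{z}$ disjoint from $\overline{x}\cup\{y\}$ and all $u(\overline{x},\overline{z}),v(\overline{x},\overline{z})\in\mathrm{Tm}_{\mathcal{L}}(\overline{x},\overline{z})$, \[\{u\wedge s\}\models_{\mathsf{V}} t\vee v\iff \text{for all }k\in K:\ \{u\wedge s'_k\}\models_{\mathsf{V}} t'_k\vee v.\] Then the first-order theory of $\mathsf{V}_\rhd$ has a model completion.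
   Context: $\mathcal{L}=\{\wedge,\vee,\cdot,\backslash,/,\mathrm{e},0\}$ is the language of pointed residuated lattices; $\mathrm{Tm}_{\mathcal{L}}(\overline{x})$ is the set of $\mathcal{L}$-terms in variables $\overline{x}$. A pointed residuated lattice is an $\mathcal{L}$-algebra such that $\langle A,\wedge,\vee\rangle$ is a lattice (with order $\le$), $\langle A,\cdot,\mathrm{e}\rangle$ is a monoid, and $b\le a\backslash c\iff a\cdot b\le c\iff a\le c/b$. For a variety $\mathsf{V}$ of pointed residuated lattices, $\mathsf{V}^c$ is the class of its linearly ordered members, and $\mathsf{V}$ is semilinear if it is the class of isomorphic copies of subalgebras of products of members of $\mathsf{V}^c$. $\mathcal{L}_\rhd$ is $\mathcal{L}$ plus a binary symbol $\rhd$. $\mathsf{V}^c_\rhd$ is the class of members of $\mathsf{V}^c$ expanded with $x\rhd y:=y$ if $\mathrm{e}\le x$ and $x\rhd y:=\mathrm{e}$ otherwise; $\mathsf{V}_\rhd$ is the variety of $\mathcal{L}_\rhd$-algebras generated by $\mathsf{V}^c_\rhd$. For a class $\mathsf{K}$ and finite set of terms $\Gamma\cup\{t\}$, $\Gamma\models_{\mathsf{K}}t$ means that every member of $\mathsf{K}$ satisfies $\bigwedge\{\mathrm{e}\le s: s\in\Gamma\}\to\mathrm{e}\le t$ under every assignment (where $a\le b$ abbreviates $a\wedge b\approx a$). $\Lambda$ is a formal symbol with the conventions $s\vee\Lambda:=s$ and $\Lambda\vee s:=s$ for every term $s$. A model completion of a theory $T$ is a model complete theory with the same universal consequences as $T$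 such that for every model $M$ of $T$, it together with the diagram of $M$ is complete. *)

(* Defs.v *)
From Stdlib Require Import List Arith.
Import ListNotations.

Record Lstr := {
  car :> Type;
  mt : car -> car -> car;
  jn : car -> car -> car;
  ml : car -> car -> car;
  ld : car -> car -> car;
  rd : car -> car -> car;
  un : car;
  zr : car
}.

Definition le (A : Lstr) (a b : A) : Prop := mt A a b = a.

Definition PRL (A : Lstr) : Prop :=
  (forall a b c, mt A a (mt A b c) = mt A (mt A a b) c) /\
  (forall a b, mt A a b = mt A b a) /\
  (forall a b c, jn A a (jn A b c) = jn A (jn A a b) c) /\
  (forall a b, jn A a b = jn A b a) /\
  (forall a b, mt A a (jn A a b) = a) /\
  (forall a b, jn A a (mt A a b) = a) /\
  (forall a b c, ml A a (ml A b c) = ml A (ml A a b) c) /\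
  (forall a, ml A (un A) a = a) /\
  (forall a, ml A a (un A) = a) /\
  (forall a b c, (le A b (ld A a c) <-> le A (ml A a b) c) /\
                 (le A (ml A a b) c <-> le A a (rd A c b))).

Definition linear (A : Lstr) : Prop := forall a b, le A a b \/ le A b a.

Definition Lhom (A B : Lstr) (h : A -> B) : Prop :=
  (forall a b, h (mt A a b) = mt B (h a) (h b)) /\
  (forall a b, h (jn A a b) = jn B (h a) (h b)) /\
  (forall a b, h (ml A a b) = ml B (h a) (h b)) /\
  (forall a b, h (ld A a b) = ld B (h a) (h b)) /\
  (forall a b, h (rd A a b) = rd B (h a) (h b)) /\
  h (un A) = un B /\ h (zr A) = zr B.

Inductive term :=
| tvar (n : nat)
| tmeet (s t : term) | tjoin (s t : term) | tmul (s t : term)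
| tld (s t : term) | trd (s t : term)
| te | tzero.

Fixpoint eval (A : Lstr) (rho : nat -> A) (t : term) : A :=
  match t with
  | tvar n => rho n
  | tmeet s u => mt A (eval A rho s) (eval A rho u)
  | tjoin s u => jn A (eval A rho s) (eval A rho u)
  | tmul s u => ml A (eval A rho s) (eval A rho u)
  | tld s u => ld A (eval A rho s) (eval A rho u)
  | trd s u => rd A (eval A rho s) (eval A rho u)
  | te => un A
  | tzero => zr A
  end.

Fixpoint vars (t : term) : list nat :=
  match t with
  | tvar n => [n]
  | tmeet s u | tjoin s u | tmul s u | tld s u | trd s u => vars s ++ vars u
  | te | tzero => []
  end.

Definition term_in (X : list nat) (t : term) : Prop :=
  forall n, In n (vars t) -> In n X.

(* option term = Tm_L(X) \cup {Lambda}, with None = Lambda *)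
Definition oterm_in (X : list nat) (t : option term) : Prop :=
  match t with None => True | Some t => term_in X t end.

Definition ojoin (t : option term) (v : term) : term :=
  match t with None => v | Some t => tjoin t v end.

(* A variety of pointed residuated lattices is presented by a set E of
   L-equations: V = the pointed residuated lattices satisfying E. *)
Definition inV (E : term -> term -> Prop) (A : Lstr) : Prop :=
  PRL A /\ forall l r, E l r -> forall rho : nat -> A, eval A rho l = eval A rho r.

Definition inVc (E : term -> term -> Prop) (A : Lstr) : Prop :=
  inV E A /\ linear A.

(* V is the class of isomorphic copies of subalgebras of products of members
   of V^c: A is (isomorphic to) a subalgebra of prod_i B_i iff there is a
   jointly injective family of homomorphisms A -> B_i. *)
Definition semilinear (E : term -> term -> Prop) : Prop :=
  forall A : Lstr, inV E A <->
    exists (I : Type) (B : I -> Lstr),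
      (forall i, inVc E (B i)) /\
      exists h : forall i, A -> B i,
        (forall i, Lhom A (B i) (h i)) /\
        (forall a b, (forall i, h i a = h i b) -> a = b).

Definition conseq (E : term -> term -> Prop) (G : list term) (t : term) : Prop :=
  forall A : Lstr, inV E A -> forall rho : nat -> A,
    (forall s, In s G -> le A (un A) (eval A rho s)) -> le A (un A) (eval A rho t).

Record Rstr := { rb :> Lstr; rh : rb -> rb -> rb }.

(* L_|> terms with constants from C (C = Empty_set: pure language) *)
Inductive rtm (C : Type) :=
| rvar (n : nat) | rcst (c : C)
| rmeet (s t : rtm C) | rjoin (s t : rtm C) | rmul (s t : rtm C)
| rld (s t : rtm C) | rrd (s t : rtm C) | rrh (s t : rtm C)
| re | rzero.
Arguments rvar {C}. Arguments rcst {C}. Arguments rmeet {C}. Arguments rjoin {C}.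
Arguments rmul {C}. Arguments rld {C}. Arguments rrd {C}. Arguments rrh {C}.
Arguments re {C}. Arguments rzero {C}.

Fixpoint reval {C : Type} (M : Rstr) (c : C -> M) (rho : nat -> M) (t : rtm C) : M :=
  match t with
  | rvar n => rho n
  | rcst k => c k
  | rmeet s u => mt M (reval M c rho s) (reval M c rho u)
  | rjoin s u => jn M (reval M c rho s) (reval M c rho u)
  | rmul s u => ml M (reval M c rho s) (reval M c rho u)
  | rld s u => ld M (reval M c rho s) (reval M c rho u)
  | rrd s u => rd M (reval M c rho s) (reval M c rho u)
  | rrh s u => rh M (reval M c rho s) (reval M c rho u)
  | re => un M
  | rzero => zr M
  end.

Fixpoint rvars {C : Type} (t : rtm C) : list nat :=
  match t with
  | rvar n => [n]
  | rcst _ => []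
  | rmeet s u | rjoin s u | rmul s u | rld s u | rrd s u | rrh s u => rvars s ++ rvars u
  | re | rzero => []
  end.

Inductive fm (C : Type) :=
| fEq (s t : rtm C) | fBot
| fNot (p : fm C) | fAnd (p q : fm C) | fOr (p q : fm C) | fImp (p q : fm C)
| fAll (n : nat) (p : fm C) | fEx (n : nat) (p : fm C).
Arguments fEq {C}. Arguments fBot {C}. Arguments fNot {C}. Arguments fAnd {C}.
Arguments fOr {C}. Arguments fImp {C}. Arguments fAll {C}. Arguments fEx {C}.

Definition upd {X : Type} (rho : nat -> X) (n : nat) (a : X) : nat -> X :=
  fun m => if Nat.eqb m n then a else rho m.

Fixpoint holds {C : Type} (M : Rstr) (c : C -> M) (rho : nat -> M) (p : fm C) : Prop :=
  match p with
  | fEq s t => reval M c rho s = reval M c rho t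
  | fBot => False
  | fNot q => ~ holds M c rho q
  | fAnd q r => holds M c rho q /\ holds M c rho r
  | fOr q r => holds M c rho q \/ holds M c rho r
  | fImp q r => holds M c rho q -> holds M c rho r
  | fAll n q => forall a : M, holds M c (upd rho n a) q
  | fEx n q => exists a : M, holds M c (upd rho n a) q
  end.

Fixpoint fv {C : Type} (p : fm C) : list nat :=
  match p with
  | fEq s t => rvars s ++ rvars t
  | fBot => []
  | fNot q => fv q
  | fAnd q r | fOr q r | fImp q r => fv q ++ fv r
  | fAll n q | fEx n q => remove Nat.eq_dec n (fv q)
  end.

Definition sentence {C : Type} (p : fm C) : Prop := fv p = [].

Fixpoint qfree {C : Type} (p : fm C) : Prop :=
  match p with
  | fEq _ _ | fBot => True
  | fNot q => qfree q
  | fAnd q r | fOr q r | fImp q r => qfree q /\ qfree r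
  | fAll _ _ | fEx _ _ => False
  end.

Fixpoint universal {C : Type} (p : fm C) : Prop :=
  match p with
  | fAll _ q => universal q
  | _ => qfree p
  end.

Definition noconst (M : Rstr) : Empty_set -> M := fun e => match e with end.

Definition sat (M : Rstr) (p : fm Empty_set) : Prop :=
  forall rho : nat -> M, holds M (noconst M) rho p.

Definition theory := fm Empty_set -> Prop.

Definition Models (T : theory) (M : Rstr) : Prop := forall p, T p -> sat M p.

Definition entails (T : theory) (p : fm Empty_set) : Prop :=
  forall M : Rstr, Models T M -> sat M p.

Definition inVcR (E : term -> term -> Prop) (M : Rstr) : Prop :=
  inVc E (rb M) /\
  forall a b : M, (le M (un M) a -> rh M a b = b) /\
                  (~ le M (un M) a -> rh M a b = un M).

(* the variety generated by V^c_|>: all L_|> structures satisfying every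
   L_|> equation valid in V^c_|> *)
Definition inVR (E : term -> term -> Prop) (M : Rstr) : Prop :=
  forall l r : rtm Empty_set,
    (forall N : Rstr, inVcR E N -> forall rho : nat -> N,
        reval N (noconst N) rho l = reval N (noconst N) rho r) ->
    forall rho : nat -> M, reval M (noconst M) rho l = reval M (noconst M) rho r.

Definition ThVR (E : term -> term -> Prop) : theory :=
  fun p => sentence p /\ forall M : Rstr, inVR E M -> sat M p.

Definition embedding (M N : Rstr) (h : M -> N) : Prop :=
  (forall a b, h a = h b -> a = b) /\ Lhom (rb M) (rb N) h /\
  (forall a b, h (rh M a b) = rh N (h a) (h b)).

Definition model_complete (T : theory) : Prop :=
  forall (M N : Rstr) (h : M -> N), Models T M -> Models T N -> embedding M N h ->
    forall (p : fm Empty_set) (rho : nat -> M),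
      holds M (noconst M) rho p <-> holds N (noconst N) (fun n => h (rho n)) p.

Definition diagram (M : Rstr) (p : fm M) : Prop :=
  sentence p /\
  (exists s t : rtm M, p = fEq s t \/ p = fNot (fEq s t)) /\
  forall rho : nat -> M, holds M (fun a => a) rho p.

Definition ModelsTD (T : theory) (M : Rstr) (N : Rstr) (c : M -> N) : Prop :=
  Models T N /\ forall p, diagram M p -> forall rho : nat -> N, holds N c rho p.

Definition entailsTD (T : theory) (M : Rstr) (p : fm M) : Prop :=
  forall (N : Rstr) (c : M -> N), ModelsTD T M N c ->
    forall rho : nat -> N, holds N c rho p.

Definition completeTD (T : theory) (M : Rstr) : Prop :=
  (exists (N : Rstr) (c : M -> N), ModelsTD T M N c) /\
  forall p : fm M, sentence p -> entailsTD T M p \/ entailsTD T M (fNot p).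

Definition model_completion (T Ts : theory) : Prop :=
  (forall p, Ts p -> sentence p) /\
  model_complete Ts /\
  (forall p, sentence p -> universal p -> (entails T p <-> entails Ts p)) /\
  (forall M : Rstr, Models T M -> completeTD Ts M).

Definition has_model_completion (T : theory) : Prop :=
  exists Ts : theory, model_completion T Ts.

(* Main.v *)
Require Import Defs.
From Stdlib Require Import List Arith Lia Classical ClassicalEpsilon
  FunctionalExtensionality PropExtensionality.
From mathcomp Require filter.
Import ListNotations.

(** Over a chain of V^c every condition on an L_|>-tuple splits into finitely many
    conditions [e <= s /\ ~ e <= t] with L-terms, and by compactness the hypothesis
    makes "some larger chain contains a [y] with [e <= s(x,y)] and [~ e <= t(x,y)]"
    quantifier-free over nontrivial chains. Hence these chains embed in existentially
    closed ones. A member of V_|> is a subdirect product of chains, because a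
    quasi-identity is equivalent over chains to an identity using [|>]. Replacing the
    chains by existentially closed extensions and taking all locally constant functions
    on Baire space gives the special models. There an existential condition holds as
    soon as it can be met at single points, since the witnesses can be patched; over a
    chain the pointwise conditions are equations or negated equations. The only
    obstruction is that every equation holds in the one-element algebra, so points where
    a tuple collapses have to be supplied separately, as finitely supported functions.
    The common theory of the special models is the model completion. *)

(** The positive part of a condition must be a single equation, but elimination over chains yields a
    disjunction of pairs [e <= s_k], [~ e <= t_k]. Over a chain a join expresses the disjunction and
    [t |> f] the negation, provided [f] is false. There may be no term that is false in every
    nontrivial chain: if [0 = e], all terms can take the value [e]. [collapse X] is the substitute,
    because where it is true every term in the variables [X] equals [e], so all equations between
    such terms hold anyway.

    Several negated equations have to be refuted by one witness, although they may be refutable only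
    at a single point and by incompatible values. In Baire space every neighbourhood splits into
    infinitely many pieces, so each negated equation gets a piece of its own.

    Whether some nontrivial chain has [0 = e] depends on [E] alone, so tail indices occur in all
    families or in none, and elimination is uniform over the families. The resulting quantifier
    elimination for the common theory gives model completeness and completeness over diagrams at
    once, with no appeal to amalgamation. *)

(** * Homomorphisms and the truth of conditions *)

Inductive binop := bmt | bjn | bml | bld | brd | brh.

(** Treating the six operations uniformly lets each preservation argument be done once. *)
Definition ap (b : binop) (M : Rstr) : M -> M -> M :=
  match b with
  | bmt => mt M | bjn => jn M | bml => ml M | bld => ld M | brd => rd M
  | brh => @rh M
  end.

Definition Rhom (M N : Rstr) (h : M -> N) : Prop :=
  (forall b x y, h (ap b M x y) = ap b N (h x) (h y)) /\
  h (un M) = un N /\ h (zr M) = zr N.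

Lemma Rhom_embedding (M N : Rstr) (h : M -> N) :
  Rhom M N h -> (forall a b, h a = h b -> a = b) -> embedding M N h.
Proof.
  intros (Hb & Hu & Hz) Hi. split; [exact Hi|]. split.
  - repeat split; auto; intros a b.
    + exact (Hb bmt a b).
    + exact (Hb bjn a b).
    + exact (Hb bml a b).
    + exact (Hb bld a b).
    + exact (Hb brd a b).
  - exact (Hb brh).
Qed.

Lemma embedding_Rhom (M N : Rstr) (h : M -> N) :
  embedding M N h -> Rhom M N h.
Proof.
  intros (_ & (H1 & H2 & H3 & H4 & H5 & H6 & H7) & H8).
  split; [|tauto]. intros [] x y; simpl; auto.
Qed.

Lemma reval_hom (C : Type) (M N : Rstr) (h : M -> N) (c : C -> M) (c' : C -> N)
    rho rho' (t : rtm C) :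
  Rhom M N h -> (forall k, h (c k) = c' k) ->
  (forall n, In n (rvars t) -> h (rho n) = rho' n) ->
  h (reval M c rho t) = reval N c' rho' t.
Proof.
  intros (Hb & Hu & Hz) Hc.
  induction t; simpl; intros Hv; auto;
    rewrite <- IHt1, <- IHt2 by (intros; apply Hv, in_or_app; auto).
  - exact (Hb bmt _ _).
  - exact (Hb bjn _ _).
  - exact (Hb bml _ _).
  - exact (Hb bld _ _).
  - exact (Hb brd _ _).
  - exact (Hb brh _ _).
Qed.

Lemma reval_ext (C : Type) (M : Rstr) (c c' : C -> M) rho rho' (t : rtm C) :
  (forall k, c k = c' k) -> (forall n, In n (rvars t) -> rho n = rho' n) ->
  reval M c rho t = reval M c' rho' t.
Proof.
  intros Hc Hv. apply (reval_hom C M M (fun x => x)); auto.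
  split; auto.
Qed.

Fixpoint r_of {C : Type} (t : term) : rtm C :=
  match t with
  | tvar n => rvar n
  | tmeet s u => rmeet (r_of s) (r_of u)
  | tjoin s u => rjoin (r_of s) (r_of u)
  | tmul s u => rmul (r_of s) (r_of u)
  | tld s u => rld (r_of s) (r_of u)
  | trd s u => rrd (r_of s) (r_of u)
  | te => re
  | tzero => rzero
  end.

Lemma reval_r_of C (M : Rstr) (c : C -> M) rho t :
  reval M c rho (r_of t) = eval M rho t.
Proof. induction t; simpl; congruence. Qed.

Lemma rvars_r_of C t : rvars (r_of t : rtm C) = vars t.
Proof. induction t; simpl; congruence. Qed.

Definition tru (A : Rstr) (rho : nat -> A) (t : rtm Empty_set) : Prop :=
  le A (un A) (reval A (noconst A) rho t).

Definition otru (A : Rstr) (rho : nat -> A) (t : option (rtm Empty_set)) : Prop :=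
  match t with None => False | Some t => tru A rho t end.

(** The basic condition over chains. A second component [None] is [Lambda]; being neutral for joins,
    it counts as a false term. *)
Definition sol (A : Rstr) (rho : nat -> A)
    (p : rtm Empty_set * option (rtm Empty_set)) : Prop :=
  tru A rho (fst p) /\ ~ otru A rho (snd p).

Definition ovars (t : option (rtm Empty_set)) : list nat :=
  match t with None => [] | Some t => rvars t end.

Definition pvars (p : rtm Empty_set * option (rtm Empty_set)) : list nat :=
  rvars (fst p) ++ ovars (snd p).

Lemma Rhom_le (M N : Rstr) (h : M -> N) a b :
  Rhom M N h -> le M a b -> le N (h a) (h b).
Proof.
  intros (Hb & _) H. red. etransitivity; [symmetry; exact (Hb bmt a b)|].
  simpl. f_equal. exact H.
Qed.

Lemma embedding_le (M N : Rstr) (h : M -> N) a b :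
  embedding M N h -> (le M a b <-> le N (h a) (h b)).
Proof.
  intros H. split; [apply Rhom_le; apply embedding_Rhom; auto|].
  intros H1. destruct (embedding_Rhom _ _ _ H) as (Hb & _). destruct H as (Hi & _).
  apply Hi. etransitivity; [exact (Hb bmt a b)|exact H1].
Qed.

Lemma tru_hom (M N : Rstr) (h : M -> N) rho rho' t :
  Rhom M N h -> (forall n, In n (rvars t) -> h (rho n) = rho' n) ->
  tru M rho t -> tru N rho' t.
Proof.
  intros H Hv H1. unfold tru.
  rewrite <- (reval_hom _ M N h (noconst M) (noconst N) rho rho'); auto.
  - destruct H as (Hb & Hu & Hz). rewrite <- Hu. apply Rhom_le; auto. split; auto.
  - intros [].
Qed.

Lemma tru_emb (M N : Rstr) (h : M -> N) rho rho' t :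
  embedding M N h -> (forall n, In n (rvars t) -> h (rho n) = rho' n) ->
  (tru M rho t <-> tru N rho' t).
Proof.
  intros H Hv. pose proof (embedding_Rhom _ _ _ H) as Hr. split.
  - apply (tru_hom M N h); auto.
  - unfold tru. rewrite <- (reval_hom _ M N h (noconst M) (noconst N) rho rho'); auto.
    + destruct Hr as (Hb & Hu & Hz). rewrite <- Hu. apply embedding_le; auto.
    + intros [].
Qed.

Lemma embedding_id (M : Rstr) : embedding M M (fun x => x).
Proof. apply Rhom_embedding; auto. split; auto. Qed.

Lemma embedding_comp (M N P : Rstr) f g :
  embedding M N f -> embedding N P g -> embedding M P (fun x => g (f x)).
Proof.
  intros Hf Hg.
  destruct (embedding_Rhom _ _ _ Hf) as (F1 & F2 & F3).
  destruct (embedding_Rhom _ _ _ Hg) as (G1 & G2 & G3).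
  apply Rhom_embedding.
  - split; [|split]; [intros; rewrite F1, G1; auto|congruence|congruence].
  - destruct Hf as (If & _), Hg as (Ig & _). auto.
Qed.

Lemma tru_ext (M : Rstr) rho rho' t :
  (forall n, In n (rvars t) -> rho n = rho' n) -> (tru M rho t <-> tru M rho' t).
Proof. intros H. apply (tru_emb M M (fun x => x)); auto. apply embedding_id. Qed.

Lemma sol_emb (M N : Rstr) (h : M -> N) rho rho' p :
  embedding M N h -> (forall n, In n (pvars p) -> h (rho n) = rho' n) ->
  (sol M rho p <-> sol N rho' p).
Proof.
  intros H Hv. unfold sol. destruct p as [s [t|]]; simpl in *.
  - rewrite (tru_emb M N h rho rho' s), (tru_emb M N h rho rho' t); auto; try tauto;
      intros; apply Hv; apply in_or_app; auto.
  - rewrite (tru_emb M N h rho rho' s); auto; try tauto.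
    intros; apply Hv; apply in_or_app; auto.
Qed.

Lemma sol_ext (M : Rstr) rho rho' p :
  (forall n, In n (pvars p) -> rho n = rho' n) -> (sol M rho p <-> sol M rho' p).
Proof. intros H. apply (sol_emb M M (fun x => x)); auto. apply embedding_id. Qed.

(** * Order and truth in residuated chains *)

Section PRLBasics.
Context (A : Lstr) (HA : PRL A).

Lemma mtA a b c : mt A a (mt A b c) = mt A (mt A a b) c.
Proof. apply HA. Qed.
Lemma mtC a b : mt A a b = mt A b a.
Proof. apply HA. Qed.
Lemma jnC a b : jn A a b = jn A b a.
Proof. apply HA. Qed.
Lemma mt_jn a b : mt A a (jn A a b) = a.
Proof. apply HA. Qed.
Lemma jn_mt a b : jn A a (mt A a b) = a.
Proof. apply HA. Qed.

Lemma le_refl a : le A a a.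
Proof. red. rewrite <- (jn_mt a a) at 2. apply mt_jn. Qed.

Lemma le_antisym a b : le A a b -> le A b a -> a = b.
Proof. unfold le. intros H1 H2. rewrite mtC in H2. congruence. Qed.

Lemma le_trans a b c : le A a b -> le A b c -> le A a c.
Proof. unfold le. intros H1 H2. rewrite <- H1, <- mtA, H2. auto. Qed.

Lemma le_mt c a b : le A c (mt A a b) <-> le A c a /\ le A c b.
Proof.
  unfold le. split.
  - intros H. split.
    + rewrite <- H. rewrite <- mtA, (mtC _ a), (mtA a a b), (le_refl a). auto.
    + rewrite <- H. rewrite <- !mtA, (le_refl b). auto.
  - intros [H1 H2]. rewrite mtA, H1. auto.
Qed.

Lemma le_jnl a b : le A a (jn A a b).
Proof. apply mt_jn. Qed.

Lemma le_jnr a b : le A b (jn A a b).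
Proof. rewrite jnC. apply mt_jn. Qed.

(** Residuation turns [a <= b] into [e <= a \ b], so an equation is itself a condition of the form
    [e <= t]; the term for it is [rdif]. *)
Lemma le_dif a b : le A (un A) (mt A (ld A a b) (ld A b a)) <-> a = b.
Proof.
  assert (H : forall a b, le A (un A) (ld A a b) <-> le A a b).
  { intros x y. destruct HA as (_ & _ & _ & _ & _ & _ & _ & _ & Hu & Hr).
    destruct (Hr x (un A) y) as [H1 _]. rewrite Hu in H1. exact H1. }
  rewrite le_mt, !H. split.
  - intros [H1 H2]. apply le_antisym; auto.
  - intros ->. split; apply le_refl.
Qed.

Lemma le_jn_linear c a b : linear A -> (le A c (jn A a b) <-> le A c a \/ le A c b).
Proof.
  intros HL. split.
  - intros H. assert (Hle : forall x y, le A x y -> jn A x y = y).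
    { intros x y Hxy. red in Hxy. rewrite <- Hxy at 1. rewrite jnC, mtC. apply jn_mt. }
    destruct (HL a b) as [H1|H1].
    + rewrite Hle in H; auto.
    + rewrite jnC, Hle in H; auto.
  - intros [H|H]; eapply le_trans; eauto; [apply le_jnl|apply le_jnr].
Qed.

End PRLBasics.

Definition rdif {C} (s t : rtm C) : rtm C := rmeet (rld s t) (rld t s).

Section Chains.
Context (E : term -> term -> Prop) (A : Rstr) (HA : inVcR E A).

Lemma chain_PRL : PRL A.
Proof. apply HA. Qed.
Lemma chain_linear : linear A.
Proof. apply HA. Qed.

Lemma tru_dif rho s t :
  tru A rho (rdif s t) <-> reval A (noconst A) rho s = reval A (noconst A) rho t.
Proof. apply le_dif. apply chain_PRL. Qed.

Lemma tru_meet rho s t : tru A rho (rmeet s t) <-> tru A rho s /\ tru A rho t.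
Proof. apply le_mt. apply chain_PRL. Qed.

Lemma tru_join rho s t : tru A rho (rjoin s t) <-> tru A rho s \/ tru A rho t.
Proof. apply le_jn_linear; [apply chain_PRL|apply chain_linear]. Qed.

Lemma tru_re rho : tru A rho re.
Proof. apply le_refl. apply chain_PRL. Qed.

Lemma reval_rrh rho s t :
  (tru A rho s -> reval A (noconst A) rho (rrh s t) = reval A (noconst A) rho t) /\
  (~ tru A rho s -> reval A (noconst A) rho (rrh s t) = un A).
Proof. destruct HA as [_ H]. split; intros; apply H; auto. Qed.

Lemma tru_rrh rho s t : tru A rho (rrh s t) <-> (tru A rho s -> tru A rho t).
Proof.
  destruct (reval_rrh rho s t) as [H1 H2].
  destruct (classic (tru A rho s)) as [H|H].
  - unfold tru at 1. rewrite H1 by auto. unfold tru at 2. tauto.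
  - unfold tru at 1. rewrite H2 by auto.
    pose proof (le_refl A chain_PRL (un A)). tauto.
Qed.

End Chains.

(** In a residuated lattice this amounts to having two elements: if [a <> b], then [e] is not below
    the meet of [a \ b] and [b \ a]. The element [c] provides a false value to start a join of false
    terms with. *)
Definition nontrivial (A : Rstr) : Prop := exists c, ~ le A (un A) c.

Lemma nontrivial_emb M N h : embedding M N h -> nontrivial M -> nontrivial N.
Proof.
  intros H [c Hc]. exists (h c). destruct (embedding_Rhom _ _ _ H) as (_ & Hu & _).
  rewrite <- Hu. rewrite <- (embedding_le M N h); auto.
Qed.

(** * Reduced products *)

(** A subalgebra [sb] of a product, modulo a filter [fl]. Ultraproducts, direct limits and the
    special models are all instances, so the transfer of truth from the factors is proved only
    once. *)
Record redprod := {
  ix : Type;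
  fac : ix -> Rstr;
  fl : (ix -> Prop) -> Prop;
  sb : (forall i, fac i) -> Prop;
  fl_all : forall P : ix -> Prop, (forall i, P i) -> fl P;
  fl_mp : forall P Q : ix -> Prop, fl P -> fl (fun i => P i -> Q i) -> fl Q;
  sb_un : sb (fun i => un (fac i));
  sb_zr : sb (fun i => zr (fac i));
  sb_op : forall b f g, sb f -> sb g -> sb (fun i => ap b (fac i) (f i) (g i))
}.

Lemma fl_impl d (P Q : ix d -> Prop) : (forall i, P i -> Q i) -> fl d P -> fl d Q.
Proof. intros H HP. apply (fl_mp d P); auto. apply fl_all; auto. Qed.

Lemma fl_iff d (P Q : ix d -> Prop) : (forall i, P i <-> Q i) -> (fl d P <-> fl d Q).
Proof. intros H. split; apply fl_impl; intros i; apply H. Qed.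

Lemma fl_and d (P Q : ix d -> Prop) : fl d P -> fl d Q -> fl d (fun i => P i /\ Q i).
Proof.
  intros HP HQ. apply (fl_mp d Q); auto. revert HP. apply fl_impl. tauto.
Qed.

Section RP.
Context (d : redprod).

Definition cls (f : forall i, fac d i) : (forall i, fac d i) -> Prop :=
  fun g => fl d (fun i => f i = g i).

Definition rcar : Type := {X | exists f, sb d f /\ X = cls f}.

Definition rq f (H : sb d f) : rcar := exist _ (cls f) (ex_intro _ f (conj H eq_refl)).

Definition rrep (x : rcar) : {f | sb d f /\ proj1_sig x = cls f} :=
  constructive_indefinite_description _ (proj2_sig x).

Definition rop (b : binop) (x y : rcar) : rcar :=
  rq (fun i => ap b (fac d i) (proj1_sig (rrep x) i) (proj1_sig (rrep y) i))
     (sb_op d b _ _ (proj1 (proj2_sig (rrep x))) (proj1 (proj2_sig (rrep y)))).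

Definition RP : Rstr :=
  Build_Rstr
    (Build_Lstr rcar (rop bmt) (rop bjn) (rop bml) (rop bld) (rop brd)
       (rq _ (sb_un d)) (rq _ (sb_zr d)))
    (rop brh).

(** Facts are stated for arbitrary representatives, which hides the ones chosen inside [rop]. *)
Definition rep (f : forall i, fac d i) (x : RP) : Prop :=
  sb d f /\ proj1_sig x = cls f.

Lemma rep_ex (x : RP) : exists f, rep f x.
Proof. destruct (rrep x) as [f Hf]. exists f. exact Hf. Qed.

Lemma rep_q f : sb d f -> exists x : RP, rep f x.
Proof. intros H. exists (rq f H). split; auto. Qed.

Lemma cls_eq f g : cls f = cls g <-> fl d (fun i => f i = g i).
Proof.
  split.
  - intros H. change (cls f g). rewrite H. apply fl_all. auto.
  - intros H. apply functional_extensionality. intros k. apply propositional_extensionality.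
    unfold cls. split; intros H1.
    + generalize (fl_and _ _ _ H H1). apply fl_impl. intros i [? ?]. congruence.
    + generalize (fl_and _ _ _ H H1). apply fl_impl. intros i [? ?]. congruence.
Qed.

Lemma rep_eq f g x y : rep f x -> rep g y -> (x = y <-> fl d (fun i => f i = g i)).
Proof.
  intros [_ Hx] [_ Hy]. rewrite <- cls_eq, <- Hx, <- Hy. split; [congruence|].
  destruct x as [x px], y as [y py]. simpl. intros ->. f_equal. apply proof_irrelevance.
Qed.

Lemma rep_op b f g x y : rep f x -> rep g y ->
  rep (fun i => ap b (fac d i) (f i) (g i)) (ap b RP x y).
Proof.
  intros Hx Hy. split; [apply sb_op; [apply Hx|apply Hy]|].
  transitivity (proj1_sig (rop b x y)); [destruct b; reflexivity|].
  unfold rop, rq. simpl. apply cls_eq.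
  destruct (rrep x) as [f' [Sf Hf]], (rrep y) as [g' [Sg Hg]]. simpl.
  destruct Hx as [_ Hx], Hy as [_ Hy].
  assert (H1 : cls f' = cls f) by congruence. assert (H2 : cls g' = cls g) by congruence.
  apply cls_eq in H1, H2. generalize (fl_and _ _ _ H1 H2). apply fl_impl.
  intros i [-> ->]. auto.
Qed.

Lemma rep_un : rep (fun i => un (fac d i)) (un RP).
Proof. split; [apply sb_un|reflexivity]. Qed.
Lemma rep_zr : rep (fun i => zr (fac d i)) (zr RP).
Proof. split; [apply sb_zr|reflexivity]. Qed.

Lemma rep_reval (f : nat -> forall i, fac d i) (rho : nat -> RP) (t : rtm Empty_set) :
  (forall n, In n (rvars t) -> rep (f n) (rho n)) ->
  rep (fun i => reval (fac d i) (noconst _) (fun n => f n i) t) (reval RP (noconst RP) rho t).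
Proof.
  induction t; simpl; intros H.
  - apply H; auto.
  - destruct c.
  - apply (rep_op bmt); [apply IHt1|apply IHt2]; intros; apply H, in_or_app; auto.
  - apply (rep_op bjn); [apply IHt1|apply IHt2]; intros; apply H, in_or_app; auto.
  - apply (rep_op bml); [apply IHt1|apply IHt2]; intros; apply H, in_or_app; auto.
  - apply (rep_op bld); [apply IHt1|apply IHt2]; intros; apply H, in_or_app; auto.
  - apply (rep_op brd); [apply IHt1|apply IHt2]; intros; apply H, in_or_app; auto.
  - apply (rep_op brh); [apply IHt1|apply IHt2]; intros; apply H, in_or_app; auto.
  - apply rep_un.
  - apply rep_zr.
Qed.

Lemma rep_le f g x y : rep f x -> rep g y ->
  (le RP x y <-> fl d (fun i => le (fac d i) (f i) (g i))).
Proof.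
  intros Hx Hy. unfold le. apply (rep_eq _ _ _ _ (rep_op bmt _ _ _ _ Hx Hy) Hx).
Qed.

Lemma rep_tru (f : nat -> forall i, fac d i) (rho : nat -> RP) (t : rtm Empty_set) :
  (forall n, In n (rvars t) -> rep (f n) (rho n)) ->
  (tru RP rho t <-> fl d (fun i => tru (fac d i) (fun n => f n i) t)).
Proof.
  intros H. apply (rep_le _ _ _ _ rep_un (rep_reval f rho t H)).
Qed.

Lemma rep_env (rho : nat -> RP) : exists f, forall n, rep (f n) (rho n).
Proof.
  exists (fun n => proj1_sig (constructive_indefinite_description _ (rep_ex (rho n)))).
  intros n. apply (proj2_sig (constructive_indefinite_description _ (rep_ex (rho n)))).
Qed.

Lemma RP_eqn (l r : rtm Empty_set) :
  (forall i rho, reval (fac d i) (noconst _) rho l = reval (fac d i) (noconst _) rho r) ->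
  forall rho, reval RP (noconst RP) rho l = reval RP (noconst RP) rho r.
Proof.
  intros H rho. destruct (rep_env rho) as [f Hf].
  apply (rep_eq _ _ _ _ (rep_reval f rho l (fun n _ => Hf n)) (rep_reval f rho r (fun n _ => Hf n))).
  apply fl_all. auto.
Qed.

Lemma RP_inVR E : (forall i, inVcR E (fac d i)) -> inVR E RP.
Proof. intros H l r Hlr. apply RP_eqn. intros i. apply Hlr. auto. Qed.

(** All axioms are identities except residuation, an equivalence of inequalities; each inequality
    holds in the reduced product iff it holds on a set of the filter. *)
Lemma RP_inV E : (forall i, inVcR E (fac d i)) -> inV E RP.
Proof.
  intros H.
  assert (HP : forall i, PRL (fac d i)) by (intros i; apply (H i)).
  assert (Q : forall (l r : rtm Empty_set),
    (forall i rho, reval (fac d i) (noconst _) rho l = reval (fac d i) (noconst _) rho r) ->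
    forall a b c : RP, let rho := fun n => match n with 0 => a | 1 => b | _ => c end in
      reval RP (noconst RP) rho l = reval RP (noconst RP) rho r)
    by (intros; apply RP_eqn; auto).
  split.
  - set (x := @rvar Empty_set 0). set (y := @rvar Empty_set 1). set (z := @rvar Empty_set 2).
    repeat apply conj.
    + refine (Q (rmeet x (rmeet y z)) (rmeet (rmeet x y) z) _). intros; apply (HP i).
    + intros a b. refine (Q (rmeet x y) (rmeet y x) _ a b a). intros; apply (HP i).
    + refine (Q (rjoin x (rjoin y z)) (rjoin (rjoin x y) z) _). intros; apply (HP i).
    + intros a b. refine (Q (rjoin x y) (rjoin y x) _ a b a). intros; apply (HP i).
    + intros a b. refine (Q (rmeet x (rjoin x y)) x _ a b a). intros; apply (HP i).
    + intros a b. refine (Q (rjoin x (rmeet x y)) x _ a b a). intros; apply (HP i).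
    + refine (Q (rmul x (rmul y z)) (rmul (rmul x y) z) _). intros; apply (HP i).
    + intros a. refine (Q (rmul re x) x _ a a a). intros; apply (HP i).
    + intros a. refine (Q (rmul x re) x _ a a a). intros; apply (HP i).
    + intros a b c.
      destruct (rep_ex a) as [f Hf], (rep_ex b) as [g Hg], (rep_ex c) as [k Hk].
      change (ld RP a c) with (ap bld RP a c). change (rd RP c b) with (ap brd RP c b).
      change (ml RP a b) with (ap bml RP a b).
      rewrite (rep_le _ _ _ _ Hg (rep_op bld _ _ _ _ Hf Hk)).
      rewrite (rep_le _ _ _ _ (rep_op bml _ _ _ _ Hf Hg) Hk).
      rewrite (rep_le _ _ _ _ Hf (rep_op brd _ _ _ _ Hk Hg)).
      split; apply fl_iff; intros i; simpl; apply (HP i).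
  - intros l r Hlr rho. rewrite <- !(reval_r_of _ RP (noconst RP)).
    apply RP_eqn. intros i rho'. rewrite !reval_r_of. apply (H i). exact Hlr.
Qed.

(** Linearity and the definition of [|>] by cases are not equational; they survive when the filter
    decides every comparison between members of [sb]. *)
Lemma RP_inVcR E :
  (forall i, inVcR E (fac d i)) ->
  (forall f g, sb d f -> sb d g ->
    fl d (fun i => le (fac d i) (f i) (g i)) \/ fl d (fun i => ~ le (fac d i) (f i) (g i))) ->
  inVcR E RP.
Proof.
  intros H Hdec. split; [split; [apply RP_inV; auto|]|].
  - intros a b. destruct (rep_ex a) as [f Hf], (rep_ex b) as [g Hg].
    rewrite (rep_le _ _ _ _ Hf Hg), (rep_le _ _ _ _ Hg Hf).
    destruct (Hdec f g (proj1 Hf) (proj1 Hg)) as [H1|H1]; auto.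
    right. revert H1. apply fl_impl. intros i Hi.
    destruct (chain_linear E _ (H i) (f i) (g i)); tauto.
  - intros a b. destruct (rep_ex a) as [f Hf], (rep_ex b) as [g Hg].
    rewrite (rep_le _ _ _ _ rep_un Hf).
    change (rh RP a b) with (ap brh RP a b).
    rewrite (rep_eq _ _ _ _ (rep_op brh _ _ _ _ Hf Hg) Hg).
    rewrite (rep_eq _ _ _ _ (rep_op brh _ _ _ _ Hf Hg) rep_un).
    split.
    + apply fl_impl. intros i. apply (H i).
    + intros Hn. destruct (Hdec _ f (sb_un d) (proj1 Hf)) as [H1|H1]; [tauto|].
      revert H1. apply fl_impl. intros i. apply (H i).
Qed.

End RP.

Lemma ultrafilter_exists (I : Type) (F : (I -> Prop) -> Prop) :
  F (fun _ => True) -> ~ F (fun _ => False) ->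
  (forall P Q, F P -> F Q -> F (fun i => P i /\ Q i)) ->
  (forall P Q : I -> Prop, (forall i, P i -> Q i) -> F P -> F Q) ->
  exists U : (I -> Prop) -> Prop, (forall P, F P -> U P) /\
    (forall P : I -> Prop, (forall i, P i) -> U P) /\
    (forall P Q : I -> Prop, U P -> U (fun i => P i -> Q i) -> U Q) /\
    ~ U (fun _ => False) /\ forall P, U P \/ U (fun i => ~ P i).
Proof.
  intros FT F0 FI FS.
  destruct (@filter.ultraFilterLemma I F) as (U & HU & HF).
  { constructor; [exact F0|]. constructor; [exact FT|exact FI|exact FS]. }
  pose proof (@filter.ultra_proper _ _ HU) as HP.
  pose proof (@filter.filter_filter _ _ HP) as HFl.
  exists U. split; [exact HF|]. split; [|split; [|split]].
  - intros P H. apply (@filter.filterS _ _ HFl (fun _ => True)); [intros i _; apply H|].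
    apply (@filter.filterT _ _ HFl).
  - intros P Q H1 H2.
    apply (@filter.filterS _ _ HFl (fun i => P i /\ (P i -> Q i))); [intros i; simpl; tauto|].
    exact (@filter.filterI _ _ HFl _ _ H1 H2).
  - exact (@filter.filter_not_empty _ _ HP).
  - intros P. exact (@filter.in_ultra_setVsetC _ U P HU).
Qed.

(** * Compactness for chains *)

Definition phom (M A : Rstr) (l : list M) (g : M -> A) : Prop :=
  (forall b x y, In x l -> In y l -> g (ap b M x y) = ap b A (g x) (g y)) /\
  g (un M) = un A /\ g (zr M) = zr A.

Lemma dep_choice (I : Type) (A : I -> Type) (R : forall i, A i -> Prop) :
  (forall i, exists a, R i a) -> exists f : forall i, A i, forall i, R i (f i).
Proof.
  intros H. exists (fun i => proj1_sig (constructive_indefinite_description _ (H i))).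
  intros i. apply proj2_sig.
Qed.

(** An ultraproduct over the finite pieces [(l, F)] of the requirements, along an ultrafilter
    containing, for each piece, the set of all larger pieces. A single requirement concerns finitely
    many elements and so holds almost everywhere. [Neq] is left open because it serves both for
    embeddings and for separating one pair. *)
Lemma hom_by_compactness E (M : Rstr) (Neq : M -> M -> Prop) (J : Type)
    (jr : J -> nat -> M) (jy : J -> nat) (jp : J -> rtm Empty_set * option (rtm Empty_set)) :
  (forall (l : list M) (F : list J), exists (A : Rstr) (g : M -> A),
     inVcR E A /\ phom M A l g /\
     (forall a b, In a l -> In b l -> Neq a b -> g a <> g b) /\
     forall j, In j F -> exists b, sol A (upd (fun n => g (jr j n)) (jy j) b) (jp j)) ->
  exists (D : Rstr) (h : M -> D),
     inVcR E D /\ Rhom M D h /\ (forall a b, Neq a b -> h a <> h b) /\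
     forall j, exists b, sol D (upd (fun n => h (jr j n)) (jy j) b) (jp j).
Proof.
  intros H.
  set (I := (list M * list J)%type).
  destruct (dep_choice I (fun _ => Rstr) _ (fun i => H (fst i) (snd i))) as [A HA].
  destruct (dep_choice I (fun i => M -> A i) _ HA) as [g Hg]. clear HA H.
  assert (HC : forall i, inVcR E (A i)) by (intros i; apply Hg).
  destruct (ultrafilter_exists I (fun P => exists l F, forall i : I,
    incl l (fst i) -> incl F (snd i) -> P i)) as (U & HUF & HUa & HUm & HU0 & HUd).
  - exists [], []. auto.
  - intros (l & F & H). apply (H (l, F)); apply incl_refl.
  - intros P Q (l & F & H1) (l' & F' & H2). exists (l ++ l'), (F ++ F').
    intros i Hl HF. split; [apply H1|apply H2]; intros x Hx;
      (apply Hl || apply HF); apply in_or_app; auto.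
  - intros P Q HPQ (l & F & H1). exists l, F. auto.
  - pose (d := Build_redprod I A U (fun _ => True) HUa HUm Logic.I Logic.I
                 (fun _ _ _ _ _ => Logic.I)).
    assert (Hrep : forall a, exists x : RP d, rep d (fun i => g i a) x)
      by (intros a; apply rep_q; exact Logic.I).
    destruct (dep_choice M (fun _ => RP d) _ Hrep) as [h Hh]. clear Hrep.
    assert (HF : forall l F P, (forall i : I, incl l (fst i) -> incl F (snd i) -> P i) -> fl d P)
      by (intros l F P HP; apply HUF; exists l, F; exact HP).
    exists (RP d), h. split; [|split; [|split]].
    + apply RP_inVcR; [exact HC|]. intros f k _ _. apply HUd.
    + split; [|split].
      * intros b x y. apply (rep_eq d _ _ _ _ (Hh _) (rep_op d b _ _ _ _ (Hh x) (Hh y))).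
        apply (HF [x; y] []). intros i Hl _.
        destruct (Hg i) as (_ & (Hb & _) & _). apply Hb; apply Hl; simpl; auto.
      * apply (rep_eq d _ _ _ _ (Hh _) (rep_un d)). apply fl_all. intros i. apply (Hg i).
      * apply (rep_eq d _ _ _ _ (Hh _) (rep_zr d)). apply fl_all. intros i. apply (Hg i).
    + intros a b Hab Hc. apply (rep_eq d _ _ _ _ (Hh _) (Hh _)) in Hc.
      apply HU0. change (fl d (fun _ => False)).
      apply (fl_mp d _ _ Hc). apply (HF [a; b] []). intros i Hl _.
      apply (Hg i); auto; apply Hl; simpl; auto.
    + intros j.
      assert (Hb : forall i, exists b : A i, In j (snd i) ->
        sol (A i) (upd (fun n => g i (jr j n)) (jy j) b) (jp j)).
      { intros i. destruct (classic (In j (snd i))) as [Hj|Hj].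
        - destruct (Hg i) as (_ & _ & _ & Hs). destruct (Hs j Hj) as [b Hb]. eauto.
        (* The pieces whose [F] omits [j] are negligible, so any value does there. *)
        - exists (un (A i)). tauto. }
      destruct (dep_choice I (fun i => A i) _ Hb) as [b Hb'].
      destruct (rep_q d b Logic.I) as [x Hx]. exists x.
      assert (Hr : forall n, rep d (fun i => upd (fun n => g i (jr j n)) (jy j) (b i) n)
                               (upd (fun n => h (jr j n)) (jy j) x n)).
      { intros n. unfold upd. destruct (n =? jy j); [exact Hx|apply Hh]. }
      pose proof (fun t => rep_tru d _ _ t (fun n _ => Hr n)) as Ht.
      assert (Hs : fl d (fun i => sol (A i) (upd (fun n => g i (jr j n)) (jy j) (b i)) (jp j))).
      { apply (HF [] [j]). intros i _ Hl. apply Hb'. apply Hl. simpl; auto. }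
      split.
      * apply Ht. revert Hs. apply fl_impl. intros i Hi. apply Hi.
      * destruct (snd (jp j)) as [t|] eqn:Et; simpl; [|auto].
        intros Hc. apply Ht in Hc. apply HU0. change (fl d (fun _ => False)).
        apply (fl_mp d _ _ Hc). revert Hs. apply fl_impl. intros i [_ Hi].
        rewrite Et in Hi. exact Hi.
Qed.

(** * Separating points by homomorphisms into chains *)

Definition rmeets {C} (l : list (rtm C)) : rtm C := fold_right rmeet re l.

Lemma tru_meets E A rho l : inVcR E A ->
  (tru A rho (rmeets l) <-> forall t, In t l -> tru A rho t).
Proof.
  intros HA. induction l as [|t l IH]; simpl.
  - split; [tauto|]. intros _. apply (tru_re E); auto.
  - rewrite (tru_meet E), IH; auto. split.
    + intros [H1 H2] u [<-|Hu]; auto.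
    + auto.
Qed.

(* With [c := /\ (p = q)], the quasi-identity [c -> i = j] would be the identity
   [c |> i = c |> j] over chains; in [M] the hypotheses make [c] equal to an
   instance [c0] of [/\ (p = p)], and [c0 |> x = x] is an identity. *)
Lemma chain_of_quasi_identity E M (eqs : list (rtm Empty_set * rtm Empty_set)) rho i j :
  inVR E M ->
  (forall p, In p eqs -> reval M (noconst M) rho (fst p) = reval M (noconst M) rho (snd p)) ->
  rho i <> rho j ->
  exists (A : Rstr) (sg : nat -> A), inVcR E A /\
    (forall p, In p eqs -> reval A (noconst A) sg (fst p) = reval A (noconst A) sg (snd p)) /\
    sg i <> sg j.
Proof.
  intros HM Heq Hij. apply NNPP. intros Hno. apply Hij.
  set (c1 := rmeets (map (fun p => rdif (fst p) (snd p)) eqs)).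
  set (c0 := rmeets (map (fun p => rdif (fst p) (fst p)) eqs)).
  assert (T1 : forall A rho, inVcR E A -> (tru A rho c1 <->
    forall p, In p eqs -> reval A (noconst A) rho (fst p) = reval A (noconst A) rho (snd p))).
  { intros A sg HA. unfold c1. rewrite (tru_meets E); auto. split.
    - intros H p Hp. apply (tru_dif E); auto. apply H.
      apply (in_map (fun p => rdif (fst p) (snd p))). auto.
    - intros H t Ht. apply in_map_iff in Ht. destruct Ht as (p & <- & Hp).
      apply (tru_dif E); auto. }
  assert (T0 : forall A rho, inVcR E A -> tru A rho c0).
  { intros A sg HA. unfold c0. rewrite (tru_meets E); auto.
    intros t Ht. apply in_map_iff in Ht. destruct Ht as (p & <- & Hp).
    apply (tru_dif E); auto. }
  assert (I1 : reval M (noconst M) rho (rrh c1 (rvar i)) = reval M (noconst M) rho (rrh c1 (rvar j))).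
  { apply HM. intros N HN sg. destruct (classic (tru N sg c1)) as [Hc|Hc].
    - rewrite !(proj1 (reval_rrh E N HN sg _ _) Hc). simpl. apply NNPP. intros Hne.
      apply Hno. exists N, sg. split; auto. split; auto. apply T1; auto.
    - rewrite !(proj2 (reval_rrh E N HN sg _ _) Hc). auto. }
  assert (I0 : forall k, reval M (noconst M) rho (rrh c0 (rvar k)) = rho k).
  { intros k. change (rho k) with (reval M (noconst M) rho (rvar k)).
    apply HM. intros N HN sg. apply (reval_rrh E N HN sg); auto. }
  assert (Ec : reval M (noconst M) rho c1 = reval M (noconst M) rho c0).
  { unfold c1, c0. clear - Heq. induction eqs as [|p l IH]; simpl; auto.
    rewrite IH by (intros; apply Heq; simpl; auto).
    rewrite (Heq p) by (simpl; auto). auto. }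
  rewrite <- (I0 i), <- (I0 j). simpl in I1 |- *. rewrite <- Ec. exact I1.
Qed.

Definition allops := [bmt; bjn; bml; bld; brd; brh].

Definition rbin {C} (b : binop) : rtm C -> rtm C -> rtm C :=
  match b with
  | bmt => rmeet | bjn => rjoin | bml => rmul | bld => rld | brd => rrd | brh => rrh
  end.

Lemma reval_rbin C (M : Rstr) (c : C -> M) rho b s t :
  reval M c rho (rbin b s t) = ap b M (reval M c rho s) (reval M c rho t).
Proof. destruct b; reflexivity. Qed.

Definition opsl (M : Rstr) (l : list M) : list (binop * M * M) :=
  flat_map (fun b => flat_map (fun x => map (fun y => (b, x, y)) l) l) allops.

Lemma in_opsl M l b x y : In x l -> In y l -> In (b, x, y) (opsl M l).
Proof.
  intros Hx Hy. apply in_flat_map. exists b. split; [destruct b; simpl; tauto|].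
  apply in_flat_map. exists x. split; auto. apply in_map_iff. eauto.
Qed.

Arguments opsl : simpl never.

(* One extra application of every operation, so that the graphs of the
   operations on [l] are expressible with variables naming elements of the list. *)
Definition op_closure (M : Rstr) (l : list M) : list M :=
  un M :: zr M :: l ++ map (fun q => ap (fst (fst q)) M (snd (fst q)) (snd q)) (opsl M l).

Arguments op_closure : simpl never.

Lemma op_closure_l M l x : In x l -> In x (op_closure M l).
Proof. intros H. right. right. apply in_or_app. auto. Qed.

Lemma op_closure_op M l b x y : In x l -> In y l -> In (ap b M x y) (op_closure M l).
Proof.
  intros Hx Hy. right. right. apply in_or_app. right.
  apply in_map_iff. exists (b, x, y). split; auto. apply in_opsl; auto.
Qed.

Definition pos {X : Type} (d : X) (l : list X) (a : X) : nat :=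
  epsilon (inhabits 0) (fun n => nth n l d = a).

Lemma nth_pos X (d : X) l a : In a l -> nth (pos d l a) l d = a.
Proof.
  intros H. unfold pos. apply epsilon_spec. destruct (In_nth l a d H) as (n & _ & Hn). eauto.
Qed.

(** The operation tables of a finite part of [M] are finitely many equations. They cannot force
    [a0 = b0] over all chains, since that quasi-identity would then hold in [M]; compactness glues
    the resulting partial maps. This gives the subdirect representation by chains. *)
Lemma separating_chain E M a0 b0 :
  inVR E M -> a0 <> b0 ->
  exists (D : Rstr) (h : M -> D), inVcR E D /\ Rhom M D h /\ h a0 <> h b0.
Proof.
  intros HM Hab.
  destruct (hom_by_compactness E M (fun a b => a = a0 /\ b = b0) Empty_set
    (fun j => match j with end) (fun j => match j with end) (fun j => match j with end))
    as (D & h & HD & Hh & Hn & _).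
  - intros l F.
    set (l1 := a0 :: b0 :: l). set (l' := op_closure M l1). set (p := pos (un M) l').
    assert (Hp : forall a, In a l' -> nth (p a) l' (un M) = a) by (intros; apply nth_pos; auto).
    set (eqs := (@rvar Empty_set (p (un M)), @re Empty_set) :: (rvar (p (zr M)), rzero) ::
      map (fun q : binop * M * M => let '(b, x, y) := q in
        (rvar (p (ap b M x y)), rbin b (rvar (p x)) (rvar (p y)))) (opsl M l1)).
    destruct (chain_of_quasi_identity E M eqs (fun n => nth n l' (un M)) (p a0) (p b0))
      as (A & sg & HA & Heq & Hne); auto.
    + intros q [<-|[<-|Hq]].
      * apply Hp. left. reflexivity.
      * apply Hp. right. left. reflexivity.
      * apply in_map_iff in Hq. destruct Hq as ([[b x] y] & <- & Hq).
        apply in_flat_map in Hq. destruct Hq as (b' & _ & Hq).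
        apply in_flat_map in Hq. destruct Hq as (x' & Hx & Hq).
        apply in_map_iff in Hq. destruct Hq as (y' & Hq & Hy). injection Hq as <- <- <-.
        cbn [fst snd reval]. rewrite reval_rbin. cbn [reval]. rewrite !Hp; auto.
        -- apply op_closure_l; auto.
        -- apply op_closure_l; auto.
        -- apply op_closure_op; auto.
    + rewrite !Hp; auto; apply op_closure_l; simpl; auto.
    + exists A, (fun a => sg (p a)). split; auto. split; [|split].
      * split; [|split].
        -- intros b x y Hx Hy.
           specialize (Heq (rvar (p (ap b M x y)), rbin b (rvar (p x)) (rvar (p y)))).
           cbn [fst snd] in Heq. rewrite reval_rbin in Heq. apply Heq.
           right. right. apply in_map_iff. exists (b, x, y). split; auto.
           apply in_opsl; simpl; auto.
        -- apply (Heq (rvar (p (un M)), re)). left. reflexivity.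
        -- apply (Heq (rvar (p (zr M)), rzero)). right. left. reflexivity.
      * intros a b _ _ [-> ->]. auto.
      * intros [].
  - exists D, h. auto.
Qed.

(** * Splitting conditions into cases without [|>] *)

Definition lift (p : term * option term) : rtm Empty_set * option (rtm Empty_set) :=
  (r_of (fst p), option_map r_of (snd p)).

Definition cand (p q : term * option term) : term * option term :=
  (tmeet (fst p) (fst q),
   match snd p with None => snd q | Some a => Some (match snd q with None => a | Some b => tjoin a b end) end).

(** The negative halves combine through a join because in a chain [e] is below a join only if it is
    below one of the two. *)
Lemma sol_cand E A rho p q : inVcR E A ->
  (sol A rho (lift (cand p q)) <-> sol A rho (lift p) /\ sol A rho (lift q)).
Proof.
  intros HA. destruct p as [s [t|]], q as [s' [t'|]]; unfold sol, lift; simpl;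
    rewrite (tru_meet E), ?(tru_join E) by auto; tauto.
Qed.

(** A case decides, for each occurrence of [|>], whether its left argument is above [e]; under that
    condition the term agrees with an L-term. The list depends on [t] only, not on the chain. *)
Lemma rtm_cases E (t : rtm Empty_set) :
  exists L : list ((term * option term) * term), forall A rho, inVcR E A ->
    (exists q, In q L /\ sol A rho (lift (fst q))) /\
    forall q, In q L -> sol A rho (lift (fst q)) ->
      reval A (noconst A) rho t = eval A rho (snd q).
Proof.
  assert (Hte : forall A rho, inVcR E A -> sol A rho (lift (te, None))).
  { intros A rho HA. split; [apply (tru_re E); auto|simpl; auto]. }
  assert (leaf : forall (t : rtm Empty_set) (w : term),
    (forall A rho, reval A (noconst A) rho t = eval A rho w) ->
    exists L : list ((term * option term) * term), forall A rho, inVcR E A ->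
    (exists q, In q L /\ sol A rho (lift (fst q))) /\
    forall q, In q L -> sol A rho (lift (fst q)) ->
      reval A (noconst A) rho t = eval A rho (snd q)).
  { intros t0 w H. exists [((te, None), w)]. intros A rho HA. split.
    - exists ((te, None), w). split; [simpl; auto|]. apply Hte; auto.
    - intros q [<-|[]] _. apply H. }
  assert (bin : forall (f : term -> term -> term) (t1 t2 t : rtm Empty_set),
    (forall A rho w1 w2, reval A (noconst A) rho t1 = eval A rho w1 ->
       reval A (noconst A) rho t2 = eval A rho w2 ->
       reval A (noconst A) rho t = eval A rho (f w1 w2)) ->
    (exists L : list ((term * option term) * term), forall A rho, inVcR E A ->
    (exists q, In q L /\ sol A rho (lift (fst q))) /\
    forall q, In q L -> sol A rho (lift (fst q)) ->
      reval A (noconst A) rho t1 = eval A rho (snd q)) ->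
    (exists L : list ((term * option term) * term), forall A rho, inVcR E A ->
    (exists q, In q L /\ sol A rho (lift (fst q))) /\
    forall q, In q L -> sol A rho (lift (fst q)) ->
      reval A (noconst A) rho t2 = eval A rho (snd q)) ->
    exists L : list ((term * option term) * term), forall A rho, inVcR E A ->
    (exists q, In q L /\ sol A rho (lift (fst q))) /\
    forall q, In q L -> sol A rho (lift (fst q)) ->
      reval A (noconst A) rho t = eval A rho (snd q)).
  { intros f t1 t2 t0 Hf [L1 H1] [L2 H2].
    exists (flat_map (fun a => map (fun b => (cand (fst a) (fst b), f (snd a) (snd b))) L2) L1).
    intros A rho HA. destruct (H1 A rho HA) as [(q1 & I1 & S1) V1].
    destruct (H2 A rho HA) as [(q2 & I2 & S2) V2]. split.
    - exists (cand (fst q1) (fst q2), f (snd q1) (snd q2)). split.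
      + apply in_flat_map. exists q1. split; auto.
        apply (in_map (fun b => (cand (fst q1) (fst b), f (snd q1) (snd b)))); auto.
      + simpl. rewrite (sol_cand E); auto.
    - intros q Hq Hs. apply in_flat_map in Hq. destruct Hq as (a & Ha & Hq).
      apply in_map_iff in Hq. destruct Hq as (b & <- & Hb). simpl in *.
      rewrite (sol_cand E) in Hs by auto. destruct Hs as [Sa Sb]. auto. }
  induction t.
  - apply (leaf _ (tvar n)). auto.
  - destruct c.
  - apply (bin tmeet t1 t2); auto. intros; simpl; congruence.
  - apply (bin tjoin t1 t2); auto. intros; simpl; congruence.
  - apply (bin tmul t1 t2); auto. intros; simpl; congruence.
  - apply (bin tld t1 t2); auto. intros; simpl; congruence.
  - apply (bin trd t1 t2); auto. intros; simpl; congruence.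
  - destruct IHt1 as [L1 H1], IHt2 as [L2 H2].
    exists (flat_map (fun a => flat_map (fun b =>
      [(cand (cand (fst a) (fst b)) (snd a, None), snd b);
       (cand (cand (fst a) (fst b)) (te, Some (snd a)), te)]) L2) L1).
    intros A rho HA. destruct (H1 A rho HA) as [(q1 & I1 & S1) V1].
    destruct (H2 A rho HA) as [(q2 & I2 & S2) V2]. split.
    + destruct (classic (tru A rho (r_of (snd q1)))) as [Ht|Ht].
      * eexists. split.
        -- apply in_flat_map. exists q1. split; auto. apply in_flat_map. exists q2.
           split; auto. left. reflexivity.
        -- cbn [fst]. rewrite !(sol_cand E) by auto. repeat split; auto; apply S1 || apply S2.
      * eexists. split.
        -- apply in_flat_map. exists q1. split; auto. apply in_flat_map. exists q2.
           split; auto. right. left. reflexivity.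
        -- cbn [fst]. rewrite !(sol_cand E) by auto. repeat split; auto; try apply S1; try apply S2.
           apply (tru_re E); auto.
    + intros q Hq Hs. apply in_flat_map in Hq. destruct Hq as (a & Ha & Hq).
      apply in_flat_map in Hq. destruct Hq as (b & Hb & Hq).
      destruct (reval_rrh E A HA rho t1 t2) as [R1 R2]. unfold tru in R1, R2.
      destruct Hq as [<-|[<-|[]]]; cbn [fst snd] in *;
        rewrite !(sol_cand E) in Hs by auto; destruct Hs as [[Sa Sb] [Sc Sd]];
        unfold tru in Sc, Sd; simpl in Sc, Sd; unfold tru in Sc, Sd;
        rewrite (V1 a) in R1, R2 by auto.
      * rewrite R1; auto. rewrite reval_r_of in Sc. exact Sc.
      * rewrite R2; auto. rewrite reval_r_of in Sd. exact Sd.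
  - apply (leaf _ te). auto.
  - apply (leaf _ tzero). auto.
Qed.

Lemma pair_cases E (p : rtm Empty_set * option (rtm Empty_set)) :
  exists L : list (term * option term), forall A rho, inVcR E A ->
    (sol A rho p <-> exists q, In q L /\ sol A rho (lift q)).
Proof.
  destruct p as [s t]. destruct (rtm_cases E s) as [L1 H1].
  assert (Ht : exists L : list ((term * option term) * option term), forall A rho, inVcR E A ->
    (exists q, In q L /\ sol A rho (lift (fst q))) /\
    forall q, In q L -> sol A rho (lift (fst q)) ->
      (otru A rho t <-> otru A rho (option_map r_of (snd q)))).
  { destruct t as [t|].
    - destruct (rtm_cases E t) as [L2 H2].
      exists (map (fun q => (fst q, Some (snd q))) L2). intros A rho HA.
      destruct (H2 A rho HA) as [(q2 & I2 & S2) V2]. split.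
      + exists (fst q2, Some (snd q2)). split; auto.
        apply (in_map (fun q => (fst q, Some (snd q)))); auto.
      + intros q Hq Hs. apply in_map_iff in Hq. destruct Hq as (q0 & <- & Hq).
        simpl in *. unfold tru. rewrite reval_r_of, (V2 q0); auto. tauto.
    - exists [((te, None), None)]. intros A rho HA. split.
      + exists ((te, None), None). split; [simpl; auto|]. split; [apply (tru_re E); auto|simpl; auto].
      + intros q [<-|[]]. simpl. tauto. }
  destruct Ht as [L2 H2].
  exists (flat_map (fun a => map (fun b => cand (cand (fst a) (fst b)) (snd a, snd b)) L2) L1).
  intros A rho HA. destruct (H1 A rho HA) as [(q1 & I1 & S1) V1].
  destruct (H2 A rho HA) as [(q2 & I2 & S2) V2].
  assert (Hs : forall a b, In a L1 -> In b L2 -> sol A rho (lift (fst a)) -> sol A rho (lift (fst b)) ->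
    (sol A rho (s, t) <-> sol A rho (lift (snd a, snd b)))).
  { intros a b Ha Hb Sa Sb. unfold sol at 1 2. cbn [fst snd lift].
    rewrite (V2 b) by auto. unfold tru. rewrite (V1 a), reval_r_of by auto. tauto. }
  split.
  - intros H. eexists. split.
    + apply in_flat_map. exists q1. split; auto. apply in_map_iff. exists q2. split; eauto.
    + rewrite !(sol_cand E), <- Hs; auto.
  - intros (q & Hq & Sq). apply in_flat_map in Hq. destruct Hq as (a & Ha & Hq).
    apply in_map_iff in Hq. destruct Hq as (b & <- & Hb).
    rewrite !(sol_cand E) in Sq by auto. destruct Sq as [[Sa Sb] Sab].
    apply (Hs a b); auto.
Qed.

(** * Refuting consequences of V in chains *)

Definition toR (A : Lstr) : Rstr :=
  Build_Rstr A (fun a b => if excluded_middle_informative (le A (un A) a) then b else un A).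

Lemma toR_inVcR E A : inVc E A -> inVcR E (toR A).
Proof.
  intros H. split; [exact H|]. intros a b. simpl.
  destruct (excluded_middle_informative (le A (un A) a)); tauto.
Qed.

Lemma eval_Lhom (A B : Lstr) h rho t : Lhom A B h ->
  h (eval A rho t) = eval B (fun n => h (rho n)) t.
Proof.
  intros (H1 & H2 & H3 & H4 & H5 & H6 & H7). induction t; simpl; auto; congruence.
Qed.

(** In a subdirect product of chains the failure of [e <= r] shows in some factor, and the premise
    is inherited by every factor. *)
Lemma refuting_chain E w r : semilinear E -> ~ conseq E [w] r ->
  exists (B : Rstr) (rho : nat -> B), inVcR E B /\
    tru B rho (r_of w) /\ ~ tru B rho (r_of r).
Proof.
  intros Hsl Hn. apply not_all_ex_not in Hn. destruct Hn as [A Hn].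
  apply imply_to_and in Hn. destruct Hn as [HA Hn].
  apply not_all_ex_not in Hn. destruct Hn as [rho Hn].
  apply imply_to_and in Hn. destruct Hn as [Hw Hr].
  specialize (Hw w (or_introl eq_refl)).
  destruct (proj1 (Hsl A) HA) as (I & B & HB & h & Hh & Hinj).
  assert (Hi : exists i, h i (mt A (un A) (eval A rho r)) <> h i (un A)).
  { apply NNPP. intros Hno. apply Hr. red. apply Hinj. intros i.
    apply NNPP. intros Hc. apply Hno. eauto. }
  destruct Hi as [i Hi]. exists (toR (B i)), (fun n => h i (rho n)).
  split; [apply toR_inVcR; auto|]. unfold tru. rewrite !reval_r_of. simpl.
  rewrite <- !(eval_Lhom A (B i)) by auto.
  pose proof (Hh i) as (H1 & _ & _ & _ & _ & H6 & _).
  unfold le in *. rewrite <- H6, <- !H1. split; congruence.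
Qed.

Lemma chain_refutes E (C : Rstr) rho w r : inVcR E C ->
  tru C rho (r_of w) -> ~ tru C rho (r_of r) -> ~ conseq E [w] r.
Proof.
  intros HC Hw Hr H. unfold tru in *. rewrite reval_r_of in *. apply Hr. apply H.
  - apply HC.
  - intros s [<-|[]]. auto.
Qed.

Lemma tru_ojoin E (A : Rstr) rho t v : inVcR E A ->
  (tru A rho (r_of (ojoin t v)) <-> otru A rho (option_map r_of t) \/ tru A rho (r_of v)).
Proof. intros HA. destruct t; simpl; [rewrite (tru_join E) by auto|]; tauto. Qed.

Lemma tru_tmeets E A rho l : inVcR E A ->
  (tru A rho (r_of (fold_right tmeet te l)) <-> forall t, In t l -> tru A rho (r_of t)).
Proof.
  intros HA. induction l as [|t l IH]; simpl.
  - split; [tauto|]. intros _. apply (tru_re E); auto.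
  - rewrite (tru_meet E), IH; auto. split; [intros [H1 H2] u [<-|Hu]|]; auto.
Qed.

Lemma tru_tjoins E A rho v l : inVcR E A ->
  (tru A rho (r_of (fold_right tjoin v l)) <->
   tru A rho (r_of v) \/ exists t, In t l /\ tru A rho (r_of t)).
Proof.
  intros HA. induction l as [|t l IH]; simpl.
  - split; [tauto|]. intros [H|(t & [] & _)]. auto.
  - rewrite (tru_join E), IH; auto. split.
    + intros [H|[H|(u & H & H')]]; eauto.
    + intros [H|(u & [<-|H] & H')]; eauto.
Qed.

Lemma vars_fold (f : term -> term -> term) v l n :
  (forall s t, vars (f s t) = vars s ++ vars t) ->
  In n (vars (fold_right f v l)) -> In n (vars v) \/ exists t, In t l /\ In n (vars t).
Proof.
  intros Hf. induction l as [|t l IH]; simpl; auto.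
  rewrite Hf. intros H. apply in_app_or in H. destruct H as [H|H]; [eauto|].
  destruct (IH H) as [H'|(u & H1 & H2)]; eauto.
Qed.

Lemma classical_filter (X : Type) (P : X -> Prop) (l : list X) :
  exists l', forall x, In x l' <-> In x l /\ P x.
Proof.
  exists (filter (fun x => if excluded_middle_informative (P x) then true else false) l).
  intros x. rewrite filter_In. destruct (excluded_middle_informative (P x)); intuition discriminate.
Qed.

Definition Ext E (C : Rstr) (rho : nat -> C) (y : nat) p : Prop :=
  exists (D : Rstr) (h : C -> D) (b : D), inVcR E D /\ embedding C D h /\
    sol D (upd (fun n => h (rho n)) y b) p.

(** The terms [u] and [v] may use further variables [zs]; this is what allows a finite part of a
    diagram to be encoded in them. *)
Definition eliminates E xs y s t (K : list (term * option term)) : Prop :=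
  forall zs : list nat, (forall z, In z zs -> ~ In z (y :: xs)) ->
  forall u v : term, term_in (xs ++ zs) u -> term_in (xs ++ zs) v ->
    (conseq E [tmeet u s] (ojoin t v) <->
     forall k, In k K -> conseq E [tmeet u (fst k)] (ojoin (snd k) v)).

Lemma pvars_lift xs p : term_in xs (fst p) -> oterm_in xs (snd p) ->
  forall n, In n (pvars (lift p)) -> In n xs.
Proof.
  destruct p as [s [t|]]; unfold pvars; simpl; intros Hs Ht n Hn;
    apply in_app_or in Hn; rewrite ?rvars_r_of in Hn; destruct Hn as [Hn|Hn]; auto.
  destruct Hn.
Qed.

(** * Existential conditions over chains *)

Section KeyLemma.
Context (E : term -> term -> Prop) (Hsl : semilinear E).
Context (xs : list nat) (y : nat) (Hy : ~ In y xs) (s : term) (t : option term)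
  (Hs : term_in (y :: xs) s) (Ht : oterm_in (y :: xs) t)
  (K : list (term * option term))
  (HK : forall k, In k K -> term_in xs (fst k) /\ oterm_in xs (snd k))
  (Helim : eliminates E xs y s t K).

Lemma Ext_key (C : Rstr) rho : inVcR E C -> nontrivial C ->
  Ext E C rho y (lift (s, t)) -> exists k, In k K /\ sol C rho (lift k).
Proof.
  intros HC [c Hc] (D & h & b & HD & Hh & Hb). apply NNPP. intros Hno.
  (* If all [k] fail in [C], the reasons for the failures, collected in [u] and [v],
     persist in [D]; the fresh [z] keeps [v] from being an empty join. *)
  destruct (classical_filter _ (fun w => tru C rho (r_of w))
    (flat_map (fun k : term * option term => match snd k with Some w => [w] | None => [] end) K))
    as [Tt HT].
  destruct (classical_filter _ (fun w => ~ tru C rho (r_of w)) (map fst K)) as [Ff HF].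
  set (z := S (list_max (y :: xs))).
  assert (Hz : forall n, In n (y :: xs) -> n <> z).
  { intros n Hn. assert (n <= list_max (y :: xs)); [|unfold z; lia].
    pose proof (proj1 (list_max_le (y :: xs) _) (le_n _)) as H.
    rewrite Forall_forall in H. auto. }
  set (u := fold_right tmeet te Tt). set (v := fold_right tjoin (tvar z) Ff).
  assert (HTx : forall w, In w Tt -> term_in xs w).
  { intros w Hw. apply HT in Hw. destruct Hw as [Hw _]. apply in_flat_map in Hw.
    destruct Hw as (k & Hk & Hw). destruct (HK k Hk) as [_ H].
    destruct (snd k) as [w'|]; [|destruct Hw]. destruct Hw as [->|[]]. exact H. }
  assert (HFx : forall w, In w Ff -> term_in xs w).
  { intros w Hw. apply HF in Hw. destruct Hw as [Hw _]. apply in_map_iff in Hw.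
    destruct Hw as (k & <- & Hk). apply (HK k Hk). }
  set (rho' := upd (upd (fun n => h (rho n)) z (h c)) y b).
  assert (Hx : forall w, term_in xs w -> (tru C rho (r_of w) <-> tru D rho' (r_of w))).
  { intros w Hw. apply (tru_emb C D h); auto. intros n Hn. rewrite rvars_r_of in Hn.
    apply Hw in Hn. unfold rho', upd.
    rewrite (proj2 (Nat.eqb_neq n y)) by (intros ->; auto).
    rewrite (proj2 (Nat.eqb_neq n z)) by (apply Hz; simpl; auto). auto. }
  assert (Hnc : ~ conseq E [tmeet u s] (ojoin t v)).
  { assert (Hst : sol D rho' (lift (s, t))).
    { revert Hb. apply sol_ext. intros n Hn. apply (pvars_lift (y :: xs)) in Hn; auto.
      unfold rho', upd. rewrite (proj2 (Nat.eqb_neq n z)); auto. }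
    apply (chain_refutes E D rho'); auto.
    - simpl. rewrite (tru_meet E) by auto. split; [|apply Hst].
      apply (tru_tmeets E); auto. intros w Hw. apply Hx; auto. apply HT. auto.
    - rewrite (tru_ojoin E) by auto. intros [H|H]; [apply Hst; exact H|].
      apply (tru_tjoins E) in H; auto. destruct H as [H|(w & Hw & H)].
      + unfold tru in H. simpl in H. unfold rho', upd in H.
        rewrite (proj2 (Nat.eqb_neq z y)), Nat.eqb_refl in H
          by (intros Hzy; apply (Hz y); simpl; auto).
        apply Hc. apply (embedding_le C D h); auto.
        destruct (embedding_Rhom _ _ _ Hh) as (_ & Hu & _). rewrite Hu. exact H.
      + apply Hx in H; auto. apply HF in Hw. tauto. }
  apply Hnc. apply (Helim [z]).
  - intros z' [<-|[]] H. apply (Hz z H). auto.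
  - intros n Hn. apply in_or_app. left. apply vars_fold in Hn; [|auto].
    destruct Hn as [[]|(w & Hw & Hn)]. apply (HTx w Hw n Hn).
  - intros n Hn. apply in_or_app. apply vars_fold in Hn; [|auto].
    destruct Hn as [[<-|[]]|(w & Hw & Hn)]; [simpl; auto|]. left. apply (HFx w Hw n Hn).
  - intros k Hk. apply NNPP. intros Hnk.
    destruct (refuting_chain E _ _ Hsl Hnk) as (B & sg & HB & HB1 & HB2).
    simpl in HB1. rewrite (tru_meet E) in HB1 by auto. destruct HB1 as [HBu HBk].
    rewrite (tru_ojoin E) in HB2 by auto.
    assert (HBu' := proj1 (tru_tmeets E B sg Tt HB) HBu).
    (* As [k] fails in [C], either its first term is false there and is a joinand of [v], or its
       second term is true there and is a conjunct of [u]. Either way [B] cannot refute the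
       consequence. *)
    destruct (classic (tru C rho (r_of (fst k)))) as [H1|H1].
    + destruct (classic (otru C rho (option_map r_of (snd k)))) as [H2|H2].
      * apply HB2. left. destruct (snd k) as [w|] eqn:Ew; [|destruct H2].
        apply HBu'. apply HT. split; auto. apply in_flat_map. exists k. split; auto.
        rewrite Ew. simpl; auto.
      * apply Hno. exists k. split; auto. split; auto.
    + apply HB2. right. apply (tru_tjoins E); auto. right. exists (fst k). split; auto.
      apply HF. split; auto. apply in_map; auto.
Qed.

(** Let [u] be the meet of the members of [W] true in [C] and [v] the join of the false ones, based
    on [w0]. Since [k] holds, [C] refutes the consequence belonging to [k]; so elimination gives a
    chain refuting the one for [(s, t)], and such a chain agrees with [C] on [W]. *)
Lemma finite_diagram (C : Rstr) rho k (W : list term) w0 :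
  inVcR E C -> In k K -> sol C rho (lift k) ->
  (forall w, In w W -> ~ In y (vars w)) -> In w0 W -> ~ tru C rho (r_of w0) ->
  exists (A : Rstr) (sg : nat -> A), inVcR E A /\ sol A sg (lift (s, t)) /\
    forall w, In w W -> (tru A sg (r_of w) <-> tru C rho (r_of w)).
Proof.
  intros HC Hk Hsol HW Hw0 Hf0.
  destruct (classical_filter _ (fun w => tru C rho (r_of w)) W) as [Tt HT].
  destruct (classical_filter _ (fun w => ~ tru C rho (r_of w)) W) as [Ff HF].
  set (u := fold_right tmeet te Tt). set (v := fold_right tjoin w0 Ff).
  destruct (classical_filter _ (fun n => ~ In n (y :: xs)) (flat_map vars W)) as [zs Hzs].
  assert (HWx : forall w, In w W -> term_in (xs ++ zs) w).
  { intros w Hw n Hn. apply in_or_app.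
    destruct (classic (In n xs)) as [Hx|Hx]; auto. right. apply Hzs. split.
    - apply in_flat_map. eauto.
    - intros [<-|H]; auto. apply (HW w Hw). auto. }
  assert (Hnc : ~ conseq E [tmeet u s] (ojoin t v)).
  { intros Hc. rewrite (Helim zs) in Hc.
    - specialize (Hc k Hk). revert Hc. apply (chain_refutes E C rho); auto.
      + simpl. rewrite (tru_meet E) by auto. split; [|apply Hsol].
        apply (tru_tmeets E); auto. intros w Hw. apply HT; auto.
      + rewrite (tru_ojoin E) by auto. intros [H|H]; [apply Hsol; exact H|].
        apply (tru_tjoins E) in H; auto. destruct H as [H|(w & Hw & H)]; auto.
        apply HF in Hw. tauto.
    - intros z Hz. apply Hzs in Hz. tauto.
    - intros n Hn. apply vars_fold in Hn; [|auto].
      destruct Hn as [[]|(w & Hw & Hn)]. apply (HWx w); auto. apply HT in Hw. tauto.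
    - intros n Hn. apply vars_fold in Hn; [|auto].
      destruct Hn as [Hn|(w & Hw & Hn)]; [apply (HWx w0); auto|].
      apply (HWx w); auto. apply HF in Hw. tauto. }
  destruct (refuting_chain E _ _ Hsl Hnc) as (A & sg & HA & H1 & H2).
  simpl in H1. rewrite (tru_meet E) in H1 by auto. rewrite (tru_ojoin E) in H2 by auto.
  exists A, sg. split; auto. split; [split; [apply H1|]; intros H; apply H2; auto|].
  intros w Hw. split; intros H.
  - apply NNPP. intros Hn. apply H2. right. apply (tru_tjoins E); auto. right.
    exists w. split; auto. apply HF. auto.
  - destruct H1 as [H1 _]. apply (proj1 (tru_tmeets E A sg Tt HA) H1). apply HT. auto.
Qed.

(** No L-term denotes [x |> z], so [brh] gets a placeholder; [key_Ext] recovers [|>] from the truth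
    of [e <= x]. *)
Definition tbin (b : binop) (s t : term) : term :=
  match b with
  | bmt => tmeet s t | bjn => tjoin s t | bml => tmul s t | bld => tld s t
  | brd => trd s t | brh => t
  end.

Definition tdif (s t : term) : term := tmeet (tld s t) (tld t s).

(** By compactness it is enough to solve [(s, t)] above finite pieces of the diagram of [C]. Such a
    piece is a truth assignment to finitely many L-terms without [y], as treated by
    [finite_diagram]. *)
Lemma key_Ext (C : Rstr) rho k : inVcR E C -> nontrivial C ->
  In k K -> sol C rho (lift k) -> Ext E C rho y (lift (s, t)).
Proof.
  intros HC [c0 Hc0] Hk Hsol.
  destruct (hom_by_compactness E C (fun a b => a <> b) unit
    (fun _ => rho) (fun _ => y) (fun _ => lift (s, t))) as (D & h & HD & Hh & Hi & Hj).
  2:{ destruct (Hj tt) as [b Hb]. exists D, h, b. split; auto. split; auto.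
      apply Rhom_embedding; auto. intros a a' Ha. apply NNPP. intros Hne.
      apply (Hi a a'); auto. }
  intros l F.
  set (l1 := c0 :: l ++ map rho xs). set (l' := op_closure C l1). set (p := pos (un C) l').
  assert (Hp : forall a, In a l' -> nth (p a) l' (un C) = a) by (intros; apply nth_pos; auto).
  assert (Hl1 : forall a, In a l1 -> In a l') by (intros; apply op_closure_l; auto).
  (* Variables below [N] keep their values under [rho]; those from [N] on name the elements of [l'],
     so no name clashes with [y] or [xs]. *)
  set (N := S (list_max (y :: xs))).
  assert (HN : forall n, In n (y :: xs) -> n < N).
  { intros n Hn. assert (n <= list_max (y :: xs)); [|unfold N; lia].
    pose proof (proj1 (list_max_le (y :: xs) _) (le_n _)) as H.
    rewrite Forall_forall in H. auto. }
  set (sg := fun n => if n <? N then rho n else nth (n - N) l' (un C)).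
  set (v := fun a => tvar (N + p a)).
  assert (Hsgx : forall n, In n (y :: xs) -> sg n = rho n).
  { intros n Hn. unfold sg. rewrite (proj2 (Nat.ltb_lt _ _)); auto. }
  assert (Hsgv : forall a, In a l' -> sg (N + p a) = a).
  { intros a Ha. unfold sg. rewrite (proj2 (Nat.ltb_ge _ _)) by lia.
    replace (N + p a - N) with (p a) by lia. auto. }
  assert (HyN : forall a, N + p a <> y).
  { intros a Ha. assert (y < N) by (apply HN; simpl; auto). lia. }
  clearbody sg p N.
  (* The entries are: the false [c0], the two constants, the links between [xs] and the names, the
     truth value of each element (for [|>]), the equalities, and the operation tables. *)
  set (W := v c0 :: tdif (v (un C)) te :: tdif (v (zr C)) tzero ::
    map (fun x => tdif (tvar x) (v (rho x))) xs ++ map v l1 ++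
    map (fun q => tdif (v (snd (fst q))) (v (snd q))) (opsl C l1) ++
    map (fun q => tdif (v (ap (fst (fst q)) C (snd (fst q)) (snd q)))
      (tbin (fst (fst q)) (v (snd (fst q))) (v (snd q)))) (opsl C l1)).
  assert (HWy : forall w, In w W -> ~ In y (vars w)).
  { assert (Hneq : forall a, ~ In y (vars (v a))).
    { intros a [H|[]]. apply (HyN a). auto. }
    assert (Hdif : forall a b, ~ In y (vars a) -> ~ In y (vars b) -> ~ In y (vars (tdif a b))).
    { intros a b H1 H2 H. simpl in H. rewrite !in_app_iff in H. tauto. }
    intros w [<-|[<-|[<-|Hw]]]; auto.
    apply in_app_or in Hw. destruct Hw as [Hw|Hw];
      [|apply in_app_or in Hw; destruct Hw as [Hw|Hw];
        [|apply in_app_or in Hw; destruct Hw as [Hw|Hw]]];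
      apply in_map_iff in Hw; destruct Hw as (x & <- & Hx); auto.
    - apply Hdif; auto. intros [<-|[]]. auto.
    - apply Hdif; auto.
      assert (Happ : forall a b, ~ In y (vars a) -> ~ In y (vars b) -> ~ In y (vars a ++ vars b))
        by (intros; rewrite in_app_iff; tauto).
      destruct (fst (fst x)); try apply Happ; apply Hneq. }
  assert (W1 : In (tdif (v (un C)) te) W) by (right; left; reflexivity).
  assert (W2 : In (tdif (v (zr C)) tzero) W) by (right; right; left; reflexivity).
  assert (W3 : forall x, In x xs -> In (tdif (tvar x) (v (rho x))) W).
  { intros x Hx. do 3 right. apply in_or_app. left.
    apply (in_map (fun x => tdif (tvar x) (v (rho x)))); auto. }
  assert (W4 : forall a, In a l1 -> In (v a) W).
  { intros a Ha. do 3 right. apply in_or_app; right. apply in_or_app; left.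
    apply in_map; auto. }
  assert (W5 : forall a b, In a l1 -> In b l1 -> In (tdif (v a) (v b)) W).
  { intros a b Ha Hb. do 3 right. do 2 (apply in_or_app; right). apply in_or_app; left.
    apply in_map_iff. exists (bmt, a, b). split; auto. apply in_opsl; auto. }
  assert (W6 : forall b x z, In x l1 -> In z l1 ->
    In (tdif (v (ap b C x z)) (tbin b (v x) (v z))) W).
  { intros b x z Hx Hz. do 3 right. do 3 (apply in_or_app; right).
    apply in_map_iff. exists (b, x, z). split; auto. apply in_opsl; auto. }
  assert (W0 : In (v c0) W) by (left; reflexivity).
  clearbody W.
  destruct (finite_diagram C sg k W (v c0)) as (A & ta & HA & HAs & HAW); auto.
  - apply (sol_ext C sg rho); auto. intros n Hn.
    apply (pvars_lift xs) in Hn; try apply HK; auto. apply Hsgx. simpl; auto.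
  - unfold tru. simpl. rewrite Hsgv; [exact Hc0|]. apply Hl1. simpl; auto.
  - assert (HD : forall B th w w', inVcR E B ->
      (tru B th (r_of (tdif w w')) <-> eval B th w = eval B th w')).
    { intros B th w w' HB. change (r_of (tdif w w')) with (@rdif Empty_set (r_of w) (r_of w')).
      rewrite (tru_dif E) by auto. rewrite !reval_r_of. tauto. }
    assert (HAd : forall w w', In (tdif w w') W -> (eval A ta w = eval A ta w' <-> eval C sg w = eval C sg w')).
    { intros w w' Hw. rewrite <- !HD by auto. apply HAW. auto. }
    set (g := fun a => ta (N + p a)).
    assert (Hgu : g (un C) = un A).
    { apply (HAd (v (un C)) te); [exact W1|]. apply Hsgv. left. reflexivity. }
    assert (Hin1 : forall a b, In a l1 -> In b l1 -> (g a = g b <-> a = b)).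
    { intros a b Ha Hb. pose proof (HAd (v a) (v b)) as H. simpl in H.
      rewrite !Hsgv in H by auto. apply H. auto. }
    exists A, g. split; [exact HA|]. split; [|split].
    + assert (Hll : forall x, In x l -> In x l1) by (intros; right; apply in_or_app; auto).
      split; [|split; [exact Hgu|]].
      * intros b x z Hx Hz.
        pose proof (HAd _ _ (W6 b x z (Hll _ Hx) (Hll _ Hz))) as Hq. simpl in Hq.
        rewrite Hsgv in Hq by (apply op_closure_op; auto).
        destruct b; simpl in Hq |- *; rewrite ?Hsgv in Hq by auto;
          try (apply Hq; reflexivity). clear Hq.
        (* The case of [|>]: its value is determined by whether [e <= x], on which [A] and [C]
           agree. *)
        assert (Hq : tru A ta (r_of (v x)) <-> tru C sg (r_of (v x))).
        { apply HAW. auto. }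
        unfold tru in Hq. simpl in Hq. rewrite Hsgv in Hq by auto.
        destruct HC as [HC1 HC2], HA as [HA1 HA2].
        destruct (classic (le C (un C) x)) as [Hle|Hle].
        -- rewrite (proj1 (HC2 x z) Hle). symmetry. apply HA2. apply Hq. exact Hle.
        -- rewrite (proj2 (HC2 x z) Hle), Hgu. symmetry. apply HA2. intros H. apply Hle, Hq, H.
      * apply (HAd (v (zr C)) tzero); [exact W2|].
        apply Hsgv. right. left. reflexivity.
    + intros a b Ha Hb Hne Hg. apply Hne. apply Hin1; auto; right; apply in_or_app; auto.
    (* The value of [y] in [A] is the witness; [W3] identifies the values of [xs] in [A] with the
       images under [g] of their values in [C]. *)
    + intros _ _. exists (ta y). revert HAs. apply sol_ext. intros n Hn.
      apply (pvars_lift (y :: xs)) in Hn; auto. unfold upd.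
      destruct (Nat.eqb_spec n y) as [->|Hny]; auto.
      destruct Hn as [Hn|Hn]; [congruence|]. unfold g.
      symmetry. apply (HAd (tvar n) (v (rho n))).
      * auto.
      * simpl. rewrite Hsgx by (simpl; auto). rewrite Hsgv; auto.
        apply Hl1. right. apply in_or_app. right. apply in_map; auto.
Qed.

End KeyLemma.

Definition elimination E : Prop :=
  forall (xs : list nat) (y : nat), ~ In y xs ->
   forall (s : term) (t : option term),
     term_in (y :: xs) s -> oterm_in (y :: xs) t ->
     exists K : list (term * option term),
       K <> [] /\
       (forall k, In k K -> term_in xs (fst k) /\ oterm_in xs (snd k)) /\
       eliminates E xs y s t K.

Lemma term_Ext_definable E : semilinear E -> elimination E ->
  forall y p, exists K : list (term * option term),
    (forall k, In k K -> ~ In y (pvars (lift k))) /\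
    forall C rho, inVcR E C -> nontrivial C ->
      (Ext E C rho y (lift p) <-> exists k, In k K /\ sol C rho (lift k)).
Proof.
  intros Hsl Hel y [s t].
  set (xs := remove Nat.eq_dec y (pvars (lift (s, t)))).
  assert (Hy : ~ In y xs) by apply remove_In.
  assert (Hin : forall n, In n (pvars (lift (s, t))) -> In n (y :: xs)).
  { intros n Hn. destruct (Nat.eq_dec n y) as [->|Hne]; [simpl; auto|].
    right. apply in_in_remove; auto. }
  destruct (Hel xs y Hy s t) as (K & _ & HK & HE).
  - intros n Hn. apply Hin. apply in_or_app. left. simpl. rewrite rvars_r_of. auto.
  - destruct t as [t|]; simpl; auto. intros n Hn. apply Hin. apply in_or_app. right.
    simpl. rewrite rvars_r_of. auto.
  - assert (Hs : term_in (y :: xs) s).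
    { intros n Hn. apply Hin. apply in_or_app. left. simpl. rewrite rvars_r_of. auto. }
    assert (Ht : oterm_in (y :: xs) t).
    { destruct t as [t|]; simpl; auto. intros n Hn. apply Hin. apply in_or_app. right.
      simpl. rewrite rvars_r_of. auto. }
    exists K. split.
    + intros k Hk Hc. apply (pvars_lift xs) in Hc; auto; apply HK; auto.
    + intros C rho HC Hnt. split.
      * apply (Ext_key E Hsl xs y Hy s t Hs Ht K HK HE); auto.
      * intros (k & Hk & Hsol). apply (key_Ext E Hsl xs y Hy s t Hs Ht K HK HE) with k; auto.
Qed.

(** [Ext] distributes over the finite disjunction from [pair_cases], so the lists for the single
    cases are concatenated. *)
Lemma Ext_definable E : semilinear E -> elimination E ->
  forall y p, exists K : list (term * option term),
    (forall k, In k K -> ~ In y (pvars (lift k))) /\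
    forall C rho, inVcR E C -> nontrivial C ->
      (Ext E C rho y p <-> exists k, In k K /\ sol C rho (lift k)).
Proof.
  intros Hsl Hel y p. destruct (pair_cases E p) as [L HL].
  assert (HL' : forall C rho, inVcR E C -> (Ext E C rho y p <-> exists q, In q L /\ Ext E C rho y (lift q))).
  { intros C rho HC. split.
    - intros (D & h & b & HD & Hh & Hb). apply HL in Hb; auto.
      destruct Hb as (q & Hq & Hb). exists q. split; auto. exists D, h, b. auto.
    - intros (q & Hq & D & h & b & HD & Hh & Hb). exists D, h, b. split; auto. split; auto.
      apply HL; eauto. }
  assert (HK : exists K : list (term * option term),
    (forall k, In k K -> ~ In y (pvars (lift k))) /\
    forall C rho, inVcR E C -> nontrivial C ->
      ((exists q, In q L /\ Ext E C rho y (lift q)) <-> exists k, In k K /\ sol C rho (lift k))).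
  { clear HL HL'. induction L as [|q L (K & HK1 & HK2)].
    - exists []. split; [intros k []|]. intros C rho _ _.
      split; intros (q & [] & _).
    - destruct (term_Ext_definable E Hsl Hel y q) as (K' & HK1' & HK2').
      exists (K' ++ K). split.
      + intros k Hk. apply in_app_or in Hk. destruct Hk; auto.
      + intros C rho HC Hnt. split.
        * intros (q' & [<-|Hq] & Hx).
          -- apply HK2' in Hx; auto. destruct Hx as (k & Hk & Hx). exists k.
             split; auto. apply in_or_app; auto.
          -- destruct (proj1 (HK2 C rho HC Hnt)) as (k & Hk & Hx'); eauto.
             exists k. split; auto. apply in_or_app; auto.
        * intros (k & Hk & Hx). apply in_app_or in Hk. destruct Hk as [Hk|Hk].
          -- exists q. split; [simpl; auto|]. apply HK2'; eauto.
          -- destruct (proj2 (HK2 C rho HC Hnt)) as (q' & Hq' & Hx'); eauto.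
             exists q'. split; [simpl; auto|]. auto. }
  destruct HK as (K & HK1 & HK2). exists K. split; auto.
  intros C rho HC Hnt. rewrite HL' by auto. auto.
Qed.

(** * Existentially closed chains *)

Definition ec E (D : Rstr) : Prop :=
  inVcR E D /\ nontrivial D /\
  forall rho y p, Ext E D rho y p -> exists b, sol D (upd rho y b) p.

Lemma Ext_ext E C rho rho' y p :
  (forall n, In n (pvars p) -> n <> y -> rho n = rho' n) ->
  Ext E C rho y p -> Ext E C rho' y p.
Proof.
  intros H (D & h & b & HD & Hh & Hb). exists D, h, b. split; auto. split; auto.
  revert Hb. apply sol_ext. intros n Hn. unfold upd.
  destruct (Nat.eqb_spec n y); auto. rewrite H; auto.
Qed.

Section EC.
Context (E : term -> term -> Prop) (Hsl : semilinear E) (Hel : elimination E).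

(** Solvability above a chain is a quantifier-free condition, hence it persists to larger chains.
    This takes the place of amalgamating [A] with the chain containing the solution. *)
Lemma Ext_emb (C A : Rstr) h rho y p : inVcR E C -> nontrivial C -> inVcR E A ->
  embedding C A h -> Ext E C rho y p -> Ext E A (fun n => h (rho n)) y p.
Proof.
  intros HC Hn HA Hh H. destruct (Ext_definable E Hsl Hel y p) as (K & _ & HK).
  apply HK in H; auto. apply HK; auto; [apply (nontrivial_emb C A h); auto|].
  destruct H as (k & Hk & H). exists k. split; auto.
  revert H. apply (sol_emb C A h); auto.
Qed.

(** Finitely many solvable conditions are met one after the other, the remaining ones staying
    solvable by [Ext_emb]; compactness then meets all of them in one extension. *)
Lemma one_step (C : Rstr) : inVcR E C -> nontrivial C ->
  exists (A : Rstr) (h : C -> A), inVcR E A /\ embedding C A h /\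
    forall rho y p, Ext E C rho y p -> exists b, sol A (upd (fun n => h (rho n)) y b) p.
Proof.
  intros HC Hn.
  set (J := {q : (nat -> C) * nat * (rtm Empty_set * option (rtm Empty_set)) |
             Ext E C (fst (fst q)) (snd (fst q)) (snd q)}).
  set (jr := fun j : J => fst (fst (proj1_sig j))).
  set (jy := fun j : J => snd (fst (proj1_sig j))).
  set (jp := fun j : J => snd (proj1_sig j)).
  assert (Hfin : forall F : list J, exists (A : Rstr) (h : C -> A), inVcR E A /\ embedding C A h /\
    forall j, In j F -> exists b, sol A (upd (fun n => h (jr j n)) (jy j) b) (jp j)).
  { induction F as [|j F (A & h & HA & Hh & HF)].
    - exists C, (fun x => x). split; auto. split; [apply embedding_id|]. intros j [].
    - assert (Hj : Ext E A (fun n => h (jr j n)) (jy j) (jp j)).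
      { apply (Ext_emb C A); auto. apply (proj2_sig j). }
      destruct Hj as (D & k & b & HD & Hk & Hb).
      exists D, (fun x => k (h x)). split; auto.
      split; [apply (embedding_comp C A D); auto|].
      intros j' [<-|Hj']; [eauto|]. destruct (HF j' Hj') as [b' Hb'].
      exists (k b'). revert Hb'. apply (sol_emb A D k); auto.
      intros n _. unfold upd. destruct (n =? jy j'); auto. }
  destruct (hom_by_compactness E C (fun a b => a <> b) J jr jy jp) as (D & h & HD & Hh & Hi & Hj).
  - intros l F. destruct (Hfin F) as (A & h & HA & Hh & HF). exists A, h.
    split; auto. split; [|split; auto].
    + destruct (embedding_Rhom _ _ _ Hh) as (Hb & Hu & Hz). split; auto.
    + intros a b _ _ Hab H. apply Hab. apply Hh. exact H.
  - exists D, h. split; auto. split.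
    + apply Rhom_embedding; auto. intros a b Hab. apply NNPP. intros Hne. apply (Hi a b); auto.
    + intros rho y p Hx. exact (Hj (exist _ (rho, y, p) Hx)).
Qed.

(** The induction shifts the whole sequence of chains, which avoids transport between the types
    [C n]. Entries before [n] are arbitrary. *)
Lemma thread (n : nat) : forall (C : nat -> Rstr) (h : forall n, C n -> C (S n)) (b : C n),
  exists f : forall m, C m, f n = b /\ forall m, n <= m -> f (S m) = h m (f m).
Proof.
  induction n as [|n IH]; intros C h b.
  - exists (nat_rect _ b h). split; auto.
  - destruct (IH (fun m => C (S m)) (fun m => h (S m)) b) as (f & Hf & Hs).
    exists (fun m => match m with 0 => un (C 0) | S m => f m end). split; auto.
    intros [|m] Hm; [lia|]. apply Hs. lia.
Qed.

(* The direct limit is realised inside the product, as the eventually coherent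
   sequences modulo eventual equality. *)
Section Limit.
Context (C : nat -> Rstr) (h : forall n, C n -> C (S n)).
Context (HC : forall n, inVcR E (C n)) (Hnt : forall n, nontrivial (C n))
  (Hh : forall n, embedding (C n) (C (S n)) (h n))
  (Hstep : forall n rho y p, Ext E (C n) rho y p ->
     exists b, sol (C (S n)) (upd (fun m => h n (rho m)) y b) p).

Definition coh N (f : forall n, C n) : Prop := forall n, N <= n -> f (S n) = h n (f n).

Definition limit_data : redprod.
Proof.
  refine (Build_redprod nat C (fun P => exists N, forall n, N <= n -> P n)
            (fun f => exists N, coh N f) _ _ _ _ _).
  - intros P H. exists 0. auto.
  - intros P Q [N HN] [N' HN']. exists (N + N'). intros n Hn.
    apply HN'; [lia|]. apply HN. lia.
  - exists 0. intros n _. destruct (embedding_Rhom _ _ _ (Hh n)) as (_ & Hu & _). auto.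
  - exists 0. intros n _. destruct (embedding_Rhom _ _ _ (Hh n)) as (_ & _ & Hz). auto.
  - intros b f g [N HN] [N' HN']. exists (N + N'). intros n Hn.
    destruct (embedding_Rhom _ _ _ (Hh n)) as (Hb & _).
    rewrite Hb, HN, HN' by lia. auto.
Defined.

Lemma coh_tru (f : nat -> forall n, C n) N t :
  (forall v, In v (rvars t) -> coh N (f v)) ->
  forall n, N <= n -> (tru (C N) (fun v => f v N) t <-> tru (C n) (fun v => f v n) t).
Proof.
  intros Hf n Hn. induction Hn as [|n Hn IH]; [tauto|].
  rewrite IH. apply (tru_emb (C n) (C (S n)) (h n)); auto.
  intros v Hv. symmetry. apply Hf; auto.
Qed.

Lemma limit_tru (f : nat -> forall n, C n) (rho : nat -> RP limit_data) N t :
  (forall v, In v (rvars t) -> rep limit_data (f v) (rho v)) ->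
  (forall v, In v (rvars t) -> coh N (f v)) ->
  (tru (RP limit_data) rho t <-> tru (C N) (fun v => f v N) t).
Proof.
  intros Hr Hf. rewrite (rep_tru limit_data f rho t Hr). simpl. split.
  - intros [N' HN']. apply (coh_tru f N t Hf (N + N')); [lia|]. apply HN'. lia.
  - intros H. exists N. intros n Hn. apply (coh_tru f N t Hf n); auto.
Qed.

Lemma limit_sol (f : nat -> forall n, C n) (rho : nat -> RP limit_data) N p :
  (forall v, In v (pvars p) -> rep limit_data (f v) (rho v)) ->
  (forall v, In v (pvars p) -> coh N (f v)) ->
  (sol (RP limit_data) rho p <-> sol (C N) (fun v => f v N) p).
Proof.
  intros Hr Hf. destruct p as [s [t|]]; unfold sol; simpl.
  - rewrite (limit_tru f rho N s), (limit_tru f rho N t); try tauto;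
      intros; (apply Hr || apply Hf); apply in_or_app; auto.
  - rewrite (limit_tru f rho N s); try tauto;
      intros; (apply Hr || apply Hf); apply in_or_app; auto.
Qed.

Lemma limit_chain : inVcR E (RP limit_data).
Proof.
  apply RP_inVcR; [exact HC|]. intros f g [N HN] [N' HN']. simpl.
  assert (H : forall n, N + N' <= n ->
    (le (C (N + N')) (f (N + N')) (g (N + N')) <-> le (C n) (f n) (g n))).
  { intros n Hn. induction Hn as [|n Hn IH]; [tauto|].
    rewrite IH, HN, HN' by lia. apply embedding_le; auto. }
  destruct (classic (le (C (N + N')) (f (N + N')) (g (N + N')))) as [Hle|Hle].
  - left. exists (N + N'). intros n Hn. apply H; auto.
  - right. exists (N + N'). intros n Hn Hc. apply Hle. apply (H n); auto.
Qed.

Lemma limit_embedding : exists e, embedding (C 0) (RP limit_data) e.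
Proof.
  set (t := fun a : C 0 => nat_rect (fun n => C n) a h).
  assert (Ht : forall a, coh 0 (t a)) by (intros a n _; reflexivity).
  assert (Hr : forall a, exists x, rep limit_data (t a) x)
    by (intros a; apply rep_q; exists 0; apply Ht).
  destruct (dep_choice _ _ _ Hr) as [e He]. exists e.
  apply Rhom_embedding; [split; [|split]|].
  - intros b x y. apply (rep_eq limit_data _ _ _ _ (He _) (rep_op limit_data b _ _ _ _ (He x) (He y))).
    apply fl_all. intros n. induction n as [|n IH]; [reflexivity|].
    change (h n (t (ap b (C 0) x y) n) = ap b (C (S n)) (h n (t x n)) (h n (t y n))).
    destruct (embedding_Rhom _ _ _ (Hh n)) as (Hb & _). rewrite <- Hb. f_equal. exact IH.
  - apply (rep_eq limit_data _ _ _ _ (He _) (rep_un limit_data)).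
    apply fl_all. intros n. induction n as [|n IH]; [reflexivity|].
    change (h n (t (un (C 0)) n) = un (C (S n))).
    destruct (embedding_Rhom _ _ _ (Hh n)) as (_ & Hu & _). rewrite <- Hu. f_equal. exact IH.
  - apply (rep_eq limit_data _ _ _ _ (He _) (rep_zr limit_data)).
    apply fl_all. intros n. induction n as [|n IH]; [reflexivity|].
    change (h n (t (zr (C 0)) n) = zr (C (S n))).
    destruct (embedding_Rhom _ _ _ (Hh n)) as (_ & _ & Hz). rewrite <- Hz. f_equal. exact IH.
  - intros a b Hab. apply (rep_eq limit_data _ _ _ _ (He _) (He _)) in Hab.
    destruct Hab as [N HN]. specialize (HN N (le_n N)). simpl in HN.
    induction N as [|n IH]; [exact HN|]. apply IH. apply (Hh n). exact HN.
Qed.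

(** Solvability over the limit is a quantifier-free fact about finitely many elements, so it
    descends to some stage [N]; the next stage contains a solution, which persists to the limit. *)
Lemma limit_ec : ec E (RP limit_data).
Proof.
  pose proof limit_chain as HL.
  assert (Hn : nontrivial (RP limit_data)).
  { destruct limit_embedding as [e He]. apply (nontrivial_emb _ _ e He). auto. }
  split; auto. split; auto. intros rho y p Hx.
  destruct (Ext_definable E Hsl Hel y p) as (K & _ & HK).
  apply HK in Hx; auto. destruct Hx as (k & Hk & Hsol).
  destruct (rep_env limit_data rho) as [f Hf].
  assert (Hbd : forall V : list nat, exists N, forall v, In v V -> coh N (f v)).
  { induction V as [|v V [N HN]]; [exists 0; intros v []|].
    destruct (Hf v) as [[N' HN'] _]. exists (N + N').
    intros w [<-|Hw] n Hle; [apply HN'; lia|apply HN; auto; lia]. }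
  destruct (Hbd (pvars (lift k) ++ pvars p)) as [N HN].
  assert (HxN : Ext E (C N) (fun v => f v N) y p).
  { apply HK; auto. exists k. split; auto. revert Hsol. apply limit_sol; auto.
    intros v Hv. apply HN. apply in_or_app; auto. }
  apply Hstep in HxN. destruct HxN as [b Hb].
  destruct (thread (S N) C h b) as (g & Hg & Hgs).
  destruct (rep_q limit_data g (ex_intro _ (S N) Hgs)) as [x Hx]. exists x.
  apply (limit_sol (fun v => if v =? y then g else f v) (upd rho y x) (S N)).
  - intros v _. unfold upd. destruct (v =? y); auto.
  - intros v Hv. destruct (v =? y); [exact Hgs|]. intros n Hle. apply HN; [|lia].
    apply in_or_app; auto.
  - revert Hb. apply sol_ext. intros v Hv. unfold upd.
    destruct (v =? y); auto. apply (HN v); auto. apply in_or_app; auto.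
Qed.

End Limit.

Lemma ec_extension (C0 : Rstr) : inVcR E C0 -> nontrivial C0 ->
  exists (D : Rstr) (e : C0 -> D), ec E D /\ embedding C0 D e.
Proof.
  intros HC0 Hn0.
  set (X := {A : Rstr | inVcR E A /\ nontrivial A}).
  assert (Hstep : forall x : X, exists x' : X, exists h : proj1_sig x -> proj1_sig x',
    embedding _ _ h /\ forall rho y p, Ext E (proj1_sig x) rho y p ->
      exists b, sol (proj1_sig x') (upd (fun n => h (rho n)) y b) p).
  { intros [A [HA Hn]]. destruct (one_step A HA Hn) as (B & h & HB & Hh & Hs).
    exists (exist _ B (conj HB (nontrivial_emb A B h Hh Hn))), h. auto. }
  destruct (dep_choice X _ _ Hstep) as [nxt Hnxt].
  destruct (dep_choice X _ _ Hnxt) as [hh Hhh].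
  set (x0 := exist _ C0 (conj HC0 Hn0) : X).
  set (T := fun n => Nat.iter n nxt x0).
  set (C := fun n => proj1_sig (T n)).
  set (h := (fun n => hh (T n)) : forall n, C n -> C (S n)).
  assert (Hh : forall n, embedding (C n) (C (S n)) (h n)) by (intros n; apply (Hhh (T n))).
  destruct (limit_embedding C h Hh) as [e He].
  exists (RP (limit_data C h Hh)), e. split; [|exact He].
  apply limit_ec.
  - intros n. apply (proj2_sig (T n)).
  - intros n. apply (proj2_sig (T n)).
  - intros n. apply (Hhh (T n)).
Qed.

End EC.

(** * Collapsed tuples and a substitute for falsum *)

Lemma ap_un (A : Rstr) b : PRL A -> (forall x y, le A (un A) x -> rh A x y = y) ->
  ap b A (un A) (un A) = un A.
Proof.
  intros HA Hrh. pose proof HA as (_ & _ & _ & _ & _ & _ & _ & Hul & Hur & Hres).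
  assert (Hr := le_refl A HA).
  destruct b; simpl.
  - apply Hr.
  - transitivity (jn A (un A) (mt A (un A) (un A))); [f_equal; symmetry; apply Hr|].
    apply (jn_mt A HA).
  - apply Hul.
  - apply (le_antisym A HA).
    + rewrite <- (Hul (ld A (un A) (un A))). apply (proj1 (Hres _ _ _)). apply Hr.
    + apply (proj1 (Hres _ _ _)). rewrite Hul. apply Hr.
  - apply (le_antisym A HA).
    + rewrite <- (Hur (rd A (un A) (un A))). apply (proj2 (Hres _ _ _)). apply Hr.
    + apply (proj2 (Hres _ _ _)). rewrite Hur. apply Hr.
  - apply Hrh. apply Hr.
Qed.

Lemma chain_ap_un E (A : Rstr) b : inVcR E A -> ap b A (un A) (un A) = un A.
Proof. intros HA. apply ap_un; apply HA. Qed.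

Lemma reval_un E (A : Rstr) rho t : inVcR E A -> zr A = un A ->
  (forall v, In v (rvars t) -> rho v = un A) -> reval A (noconst A) rho t = un A.
Proof.
  intros HA Hz. induction t; simpl; intros Hv; auto.
  1: destruct c.
  all: rewrite IHt1, IHt2 by (intros; apply Hv, in_or_app; auto).
  - apply (chain_ap_un E A bmt HA).
  - apply (chain_ap_un E A bjn HA).
  - apply (chain_ap_un E A bml HA).
  - apply (chain_ap_un E A bld HA).
  - apply (chain_ap_un E A brd HA).
  - apply (chain_ap_un E A brh HA).
Qed.

Lemma tru_un E (A : Rstr) rho t : inVcR E A -> zr A = un A ->
  (forall v, In v (rvars t) -> rho v = un A) -> tru A rho t.
Proof.
  intros HA Hz Hv. unfold tru. rewrite (reval_un E) by auto.
  apply le_refl. apply HA.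
Qed.

(* [collapse X] holds when [X] generates the one-element subalgebra; over a
   chain where it fails it acts as falsum, and it replaces [Lambda]. *)
Definition collapse (X : list nat) : rtm Empty_set :=
  rmeets (rdif rzero re :: map (fun x => rdif (rvar x) re) X).

Lemma tru_collapse E (A : Rstr) rho X : inVcR E A ->
  (tru A rho (collapse X) <-> zr A = un A /\ forall x, In x X -> rho x = un A).
Proof.
  intros HA. unfold collapse. rewrite (tru_meets E) by auto. split.
  - intros H. split.
    + specialize (H (rdif rzero re) (or_introl eq_refl)). apply (tru_dif E) in H; auto.
    + intros x Hx. specialize (H (rdif (rvar x) re)). rewrite (tru_dif E) in H by auto.
      apply H. right. apply (in_map (fun x => rdif (rvar x) re)). auto.
  - intros [H1 H2] t [<-|Ht]; [apply (tru_dif E); auto|].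
    apply in_map_iff in Ht. destruct Ht as (x & <- & Hx). apply (tru_dif E); auto.
    apply H2; auto.
Qed.

Definition rjoins {C} (t : rtm C) (l : list (rtm C)) : rtm C := fold_right rjoin t l.

Lemma tru_joins E A rho t l : inVcR E A ->
  (tru A rho (rjoins t l) <-> tru A rho t \/ exists u, In u l /\ tru A rho u).
Proof.
  intros HA. induction l as [|u l IH]; simpl.
  - split; [tauto|]. intros [H|(u & [] & _)]. auto.
  - rewrite (tru_join E), IH; auto. split.
    + intros [H|[H|(w & H & H')]]; eauto.
    + intros [H|(w & [<-|H] & H')]; eauto.
Qed.

Lemma pvars_fst p n : In n (rvars (fst p)) -> In n (pvars p).
Proof. intros H. apply in_or_app; auto. Qed.

Lemma pvars_snd s t n : In n (rvars t) -> In n (pvars (s, Some t)).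
Proof. intros H. apply in_or_app; auto. Qed.

Section Conditions.
Context (E : term -> term -> Prop) (Hsl : semilinear E) (Hel : elimination E).

(** The term is the join of the elimination cases, with [~ e <= t] written as [t |> collapse X].
    Where [collapse X] is true the join is true, and correctly so, because [y = e] then solves
    [s]. *)
Lemma Ext_equation y s : exists r, forall C rho, inVcR E C -> nontrivial C ->
  (tru C rho r <-> Ext E C rho y (s, None)).
Proof.
  destruct (Ext_definable E Hsl Hel y (s, None)) as (K & HKy & HK).
  set (X := remove Nat.eq_dec y (rvars s)).
  exists (rjoins (collapse X) (map (fun k : term * option term => rmeet (r_of (fst k))
    (match snd k with None => re | Some t => rrh (r_of t) (collapse X) end)) K)).
  intros C rho HC Hn. rewrite (tru_joins E) by auto.
  destruct (classic (tru C rho (collapse X))) as [Hc|Hc].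
  - split; [intros _|auto]. apply (tru_collapse E) in Hc; auto. destruct Hc as [Hz HX].
    exists C, (fun x => x), (un C). split; auto. split; [apply embedding_id|].
    split; [|simpl; auto]. simpl. apply (tru_un E); auto.
    intros v Hv. unfold upd. destruct (Nat.eqb_spec v y); auto.
    apply HX. apply in_in_remove; auto.
  - rewrite HK by auto. split.
    + intros [H|(u & Hu & H)]; [tauto|]. apply in_map_iff in Hu.
      destruct Hu as (k & <- & Hk). exists k. split; auto.
      rewrite (tru_meet E) in H by auto. destruct H as [H1 H2]. split; [exact H1|].
      simpl. destruct (snd k) as [t|]; simpl; auto.
      rewrite (tru_rrh E) in H2 by auto. tauto.
    + intros (k & Hk & H1 & H2). right. eexists. split; [apply in_map; exact Hk|].
      rewrite (tru_meet E) by auto. split; [exact H1|]. simpl in H2.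
      destruct (snd k) as [t|]; simpl in H2; [|apply (tru_re E); auto].
      apply (tru_rrh E); auto. tauto.
Qed.

(* The negation of an existential condition is an equation unless the condition
   is satisfiable above the one-element subalgebra. *)
Lemma notExt_equation y s t :
  (exists r, forall C rho, inVcR E C -> nontrivial C ->
    (tru C rho r <-> ~ Ext E C rho y (s, Some t))) \/
  (exists X, ~ In y X /\
    (exists C, inVcR E C /\ nontrivial C /\ zr C = un C) /\
    forall C rho, inVcR E C -> nontrivial C -> zr C = un C ->
      (forall x, In x X -> rho x = un C) -> Ext E C rho y (s, Some t)).
Proof.
  destruct (Ext_definable E Hsl Hel y (s, Some t)) as (K & HKy & HK).
  set (X := flat_map (fun k => pvars (lift k)) K).
  assert (HX : forall C rho k, inVcR E C -> zr C = un C -> (forall x, In x X -> rho x = un C) ->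
    In k K -> tru C rho (r_of (fst k)) /\ (forall w, snd k = Some w -> tru C rho (r_of w))).
  { intros C rho k HC Hz Hx Hk.
    assert (Hv : forall v, In v (pvars (lift k)) -> rho v = un C).
    { intros v Hv. apply Hx. apply in_flat_map. eauto. }
    split.
    - apply (tru_un E); auto. intros v H. apply Hv. apply pvars_fst. exact H.
    - intros w Hw. apply (tru_un E); auto. intros v H. apply Hv.
      unfold lift. rewrite Hw. apply pvars_snd. exact H. }
  destruct (classic (exists C rho, inVcR E C /\ nontrivial C /\
    tru C rho (collapse X) /\ Ext E C rho y (s, Some t))) as [HP|HP].
  - right. exists X. split.
    { intros Hy. apply in_flat_map in Hy. destruct Hy as (k & Hk & Hy). apply (HKy k); auto. }
    destruct HP as (C & rho & HC & Hn & Hc & Hx). apply (tru_collapse E) in Hc; auto.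
    destruct Hc as [Hz Hc]. split; [eauto|].
    (* At a collapsed tuple all L-terms involved are true, so a [k] that holds there has [Lambda] as
       second component; it then holds at every collapsed tuple. *)
    intros C' rho' HC' Hn' Hz' Hc'. apply HK; auto.
    apply HK in Hx; auto. destruct Hx as (k & Hk & H1 & H2). exists k. split; auto.
    destruct (HX C rho k HC Hz Hc Hk) as [_ H]. destruct (HX C' rho' k HC' Hz' Hc' Hk) as [H' _].
    split; [exact H'|]. simpl in *. destruct (snd k) as [w|]; simpl in *; auto.
  (* Each conjunct negates one elimination case, [collapse X] standing for [Lambda]. Where
     [collapse X] is true, both sides of the equivalence hold, since [HP] excludes solvability
     there. *)
  - left. exists (rmeets (map (fun k : term * option term => rrh (r_of (fst k))
      (match snd k with None => collapse X | Some w => r_of w end)) K)).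
    intros C rho HC Hn. rewrite (tru_meets E) by auto.
    destruct (classic (tru C rho (collapse X))) as [Hc|Hc].
    + split.
      * intros _ Hx. apply HP. exists C, rho. auto.
      * intros _ u Hu. apply in_map_iff in Hu. destruct Hu as (k & <- & Hk).
        apply (tru_rrh E); auto. intros _. destruct (snd k) as [w|] eqn:Ew; auto.
        apply (tru_collapse E) in Hc; auto. destruct Hc as [Hz Hc].
        apply (HX C rho k); auto.
    + rewrite HK by auto. split.
      * intros H (k & Hk & H1 & H2). apply H2.
        specialize (H _ (in_map _ _ _ Hk)). rewrite (tru_rrh E) in H by auto.
        specialize (H H1). simpl. destruct (snd k); simpl; tauto.
      * intros H u Hu. apply in_map_iff in Hu. destruct Hu as (k & <- & Hk).
        apply (tru_rrh E); auto. intros H1. apply NNPP. intros H2. apply H.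
        exists k. split; auto. split; [exact H1|]. simpl.
        destruct (snd k); simpl; auto.
Qed.

(** Members of [ts] of the second kind add nothing to [rs]: the tail of a special model will always
    provide a point for them. *)
Lemma notExt_equations y s ts : exists rs XX, ~ In y XX /\
  (forall t, In t ts ->
    (exists r, In r rs /\ forall C rho, inVcR E C -> nontrivial C ->
      (tru C rho r <-> ~ Ext E C rho y (s, Some t))) \/
    ((exists C, inVcR E C /\ nontrivial C /\ zr C = un C) /\
      forall C rho, inVcR E C -> nontrivial C -> zr C = un C ->
      (forall x, In x XX -> rho x = un C) -> Ext E C rho y (s, Some t))) /\
  (forall r, In r rs -> exists t, In t ts /\ forall C rho, inVcR E C -> nontrivial C ->
      (tru C rho r <-> ~ Ext E C rho y (s, Some t))).
Proof.
  induction ts as [|t ts (rs & XX & Hy & H1 & H2)].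
  - exists [], []. repeat split; simpl; tauto.
  - destruct (notExt_equation y s t) as [(r & Hr)|(X & HXy & HC & HX)].
    + exists (r :: rs), XX. split; auto. split.
      * intros t' [<-|Ht]; [left; exists r; simpl; auto|].
        destruct (H1 t' Ht) as [(r' & Hr' & H)|H]; auto. left. exists r'. simpl; auto.
      * intros r' [<-|Hr']; [exists t; simpl; auto|].
        destruct (H2 r' Hr') as (t' & Ht' & H). exists t'. simpl; auto.
    + exists rs, (X ++ XX). split; [|split].
      * rewrite in_app_iff. tauto.
      * intros t' [<-|Ht].
        -- right. split; auto. intros; apply HX; auto. intros; auto using in_or_app.
        -- destruct (H1 t' Ht) as [H|[HC' H]]; auto. right. split; auto.
           intros; apply H; auto. intros; auto using in_or_app.
      * intros r' Hr'. destruct (H2 r' Hr') as (t' & Ht' & H). exists t'. simpl; auto.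
Qed.

End Conditions.

(** * Locally constant functions into existentially closed chains *)

(* The indices in [tail] contribute only finitely supported functions; they are
   the places where a finitely generated subalgebra is collapsed to a point. *)
Record ecfam E := {
  idx : Type;
  pt : idx -> Rstr;
  tail : idx -> Prop;
  pt_ec : forall i, ec E (pt i);
  tail_zr : forall i, tail i -> zr (pt i) = un (pt i);
  tail_ex : (exists C, inVcR E C /\ nontrivial C /\ zr C = un C) -> exists i, tail i
}.
Arguments idx {E}. Arguments pt {E}. Arguments tail {E}.

Section Special.
Context (E : term -> term -> Prop) (d : ecfam E).

Let Ix : Type := (idx d * (nat -> nat))%type.

(** Coordinate 0 numbers the pieces of Baire space among which a function over a tail index has
    finite support. Using the same bound [n] for support and dependence lets the bounds of two
    functions be combined by addition. *)
Definition local (n : nat) (f : forall q : Ix, pt d (fst q)) : Prop :=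
  (forall i b b', (forall m, m < n -> b m = b' m) -> f (i, b) = f (i, b')) /\
  (forall i b, tail d i -> n <= b 0 -> f (i, b) = un (pt d i)).

Lemma local_mono n m f : n <= m -> local n f -> local m f.
Proof.
  intros Hnm [H1 H2]. split.
  - intros i b b' H. apply H1. intros k Hk. apply H. lia.
  - intros i b Hi Hb. apply H2; auto. lia.
Qed.

(** Only the full index set lies in the filter, so this is a genuine subalgebra of the product. *)
Definition special_data : redprod.
Proof.
  refine (Build_redprod Ix (fun q => pt d (fst q)) (fun P => forall q, P q)
    (fun f => exists n, local n f) _ _ _ _ _).
  - auto.
  - auto.
  - exists 0. split; auto.
  - exists 0. split; auto. intros i b Hi _. apply tail_zr; auto.
  - intros o f g [n Hf] [m Hg]. exists (n + m).
    apply (local_mono n (n + m)) in Hf; [|lia]. apply (local_mono m (n + m)) in Hg; [|lia].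
    destruct Hf as [F1 F2], Hg as [G1 G2]. split.
    + intros i b b' H. rewrite (F1 i b b'), (G1 i b b') by auto. auto.
    + intros i b Hi Hb. rewrite F2, G2 by auto. apply (chain_ap_un E). apply (pt_ec E d i).
Defined.

Definition special : Rstr := RP special_data.

Lemma special_inVR : inVR E special.
Proof. apply RP_inVR. intros i. apply (pt_ec E d (fst i)). Qed.

Lemma special_dif rho s t :
  tru special rho (rdif s t) <-> reval special (noconst _) rho s = reval special (noconst _) rho t.
Proof.
  apply le_dif. apply (RP_inV special_data E). intros i. apply (pt_ec E d (fst i)).
Qed.

Lemma special_meet rho s t : tru special rho (rmeet s t) <-> tru special rho s /\ tru special rho t.
Proof.
  apply le_mt. apply (RP_inV special_data E). intros i. apply (pt_ec E d (fst i)).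
Qed.

Lemma special_re rho : tru special rho re.
Proof.
  apply le_refl. apply (RP_inV special_data E). intros i. apply (pt_ec E d (fst i)).
Qed.

(** The negated terms remain a list: special models need not be linear, and different terms may fail
    at different points, so they cannot be merged into one join. *)
Definition csat (N : Rstr) (rho : nat -> N) (c : rtm Empty_set * list (rtm Empty_set)) : Prop :=
  tru N rho (fst c) /\ forall t, In t (snd c) -> ~ tru N rho t.

End Special.

(** The equation [s] must be solvable at every point, which is [r0]. Each [t] must be refutable
    together with [s] at some point, which is the failure of the equation expressing unsolvability.
    Conversely, pointwise witnesses are patched into one local function. *)
Lemma special_elim E : semilinear E -> elimination E -> forall y c, exists c',
  forall (d : ecfam E) rho,
    (exists x, csat (special E d) (upd rho y x) c) <-> csat (special E d) rho c'.
Proof.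
  intros Hsl Hel y [s ts].
  destruct (Ext_equation E Hsl Hel y s) as [r0 Hr0].
  destruct (notExt_equations E Hsl Hel y s ts) as (rs & XX & HyX & Hts & Hrs).
  exists (r0, rs). intros d rho.
  assert (HC : forall i, inVcR E (pt d i)) by (intros i; apply (pt_ec E d i)).
  assert (Hnt : forall i, nontrivial (pt d i)) by (intros i; apply (pt_ec E d i)).
  destruct (rep_env (special_data E d) rho) as [f Hf].
  assert (HT : forall t, tru (special E d) rho t <->
    forall q, tru (pt d (fst q)) (fun v => f v q) t).
  { intros t. apply (rep_tru (special_data E d) f rho t). auto. }
  assert (HTx : forall x g, rep (special_data E d) g x -> forall t,
    tru (special E d) (upd rho y x) t <->
    forall q, tru (pt d (fst q)) (upd (fun v => f v q) y (g q)) t).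
  { intros x g Hg t.
    unfold special. rewrite (rep_tru (special_data E d) (fun v => if v =? y then g else f v) (upd rho y x) t).
    - simpl. split; intros H q; generalize (H q); apply tru_ext; intros v _; unfold upd;
        destruct (v =? y); auto.
    - intros v _. unfold upd. destruct (v =? y); auto. }
  split.
  - intros (x & Hs & Hn). destruct (rep_ex (special_data E d) x) as [g Hg].
    cbn [fst snd] in Hs, Hn. rewrite (HTx x g Hg) in Hs. split; cbn [fst snd].
    + apply HT. intros q. apply Hr0; auto.
      exists (pt d (fst q)), (fun z => z), (g q). split; auto. split; [apply embedding_id|].
      split; [exact (Hs q)|simpl; auto].
    + intros r Hr Hc. destruct (Hrs r Hr) as (t & Ht & Hrt).
      apply (Hn t Ht). rewrite (HTx x g Hg). intros q. apply NNPP. intros Hq.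
      rewrite HT in Hc. specialize (Hc q). apply Hrt in Hc; auto. apply Hc.
      exists (pt d (fst q)), (fun z => z), (g q). split; auto. split; [apply embedding_id|].
      split; [exact (Hs q)|exact Hq].
  - intros [H0 Hn]. cbn [fst snd] in H0, Hn. rewrite HT in H0.
    set (V := rvars s ++ flat_map rvars ts ++ XX).
    assert (Hbd : forall W : list nat, exists n, forall v, In v W -> local E d n (f v)).
    { induction W as [|v W [n Hw]]; [exists 0; intros v []|].
      destruct (Hf v) as [[m Hm] _]. exists (n + m).
      intros w [<-|Hw']; [apply (local_mono E d m)|apply (local_mono E d n)]; auto; lia. }
    (* A positive [n] keeps the spare coordinate [n] apart from coordinate 0, which governs the
       support over the tail. *)
    destruct (Hbd V) as [n0 Hn0]. set (n := S n0).
    assert (HV : forall v, In v V -> local E d n (f v)).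
    { intros v Hv. apply (local_mono E d n0); [unfold n; lia|auto]. }
    assert (HVs : forall v, In v (rvars s) -> In v V) by (intros; apply in_or_app; auto).
    assert (HVt : forall t v, In t ts -> In v (rvars t) -> In v V).
    { intros t v Ht Hv. apply in_or_app; right. apply in_or_app; left.
      apply in_flat_map; eauto. }
    assert (HVx : forall v, In v XX -> In v V).
    { intros v Hv. apply in_or_app; right. apply in_or_app; auto. }
    assert (HVp : forall t v, In t ts -> In v (pvars (s, Some t)) -> In v V).
    { intros t v Ht Hv. apply in_app_or in Hv. destruct Hv; eauto. }
    (* The witness at [(i, b)] is chosen to refute the term of [ts] indexed by the
       coordinate [b n], on which the parameters do not depend. *)
    set (env := fun (i : idx d) (b : nat -> nat) (v : nat) => f v (i, b) : pt d i).
    (* The witness gets the bound [S n], one more than the parameters: over a tail index, at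
       [b 0 = n], the parameters are already [e] while the witness is still free. *)
    assert (HG : forall q : idx d * (nat -> nat), exists z : pt d (fst q),
      tru (pt d (fst q)) (upd (env (fst q) (snd q)) y z) s /\
      (tail d (fst q) -> S n <= snd q 0 -> z = un _) /\
      ((tail d (fst q) -> snd q 0 < S n) -> forall t, nth_error ts (snd q n) = Some t ->
        Ext E (pt d (fst q)) (env (fst q) (snd q)) y (s, Some t) ->
        ~ tru (pt d (fst q)) (upd (env (fst q) (snd q)) y z) t)).
    { intros [i b]. cbn [fst snd].
      destruct (classic (tail d i /\ S n <= b 0)) as [[Hi Hb]|Hib].
      - exists (un _). split; [|split; auto].
        + apply (tru_un E); auto; [apply tail_zr; auto|].
          intros v Hv. unfold upd. destruct (v =? y); auto. unfold env.
          apply (proj2 (HV v (HVs v Hv))); auto. lia.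
        + intros H. specialize (H Hi). lia.
      - destruct (classic (exists t, nth_error ts (b n) = Some t /\
          Ext E (pt d i) (env i b) y (s, Some t))) as [(t & Ht & Hx)|Ht].
        + apply (pt_ec E d i) in Hx. destruct Hx as (z & Hz1 & Hz2). exists z.
          split; [exact Hz1|]. split; [tauto|]. intros _ t' Ht'. rewrite Ht in Ht'.
          injection Ht' as <-. intros _. exact Hz2.
        + specialize (H0 (i, b)). apply Hr0 in H0; auto. apply (pt_ec E d i) in H0.
          destruct H0 as (z & Hz & _). exists z. split; [exact Hz|]. split; [tauto|].
          intros _ t' Ht' Hx. exfalso. apply Ht. eauto. }
    destruct (dep_choice _ _ _ HG) as [Y HY]. clear HG.
    (* Cutting [b] off after coordinate [n] makes the choice of witness depend on the coordinates up
       to [n] only. *)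
    set (tr := fun (b : nat -> nat) m => if m <? S n then b m else 0).
    assert (Htr : forall b m, m < S n -> tr b m = b m).
    { intros b m Hm. unfold tr. rewrite (proj2 (Nat.ltb_lt _ _)); auto. }
    assert (Henv : forall i b b' v, (forall m, m < n -> b m = b' m) -> In v V ->
      env i b v = env i b' v).
    { intros i b b' v Hb Hv. unfold env. apply (proj1 (HV v Hv)). auto. }
    set (g := (fun q => Y (fst q, tr (snd q))) : forall q : idx d * (nat -> nat), pt d (fst q)).
    assert (Hg : local E d (S n) g).
    { split.
      - intros i b b' Hb. unfold g. cbn [fst snd].
        assert (Hbb : tr b = tr b').
        { apply functional_extensionality. intros m. unfold tr.
          destruct (Nat.ltb_spec m (S n)); auto. }
        rewrite Hbb. reflexivity.
      - intros i b Hi Hb. unfold g. cbn [fst snd]. destruct (HY (i, tr b)) as (_ & H & _).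
        apply H; [exact Hi|]. cbn [snd]. rewrite Htr by lia. auto. }
    destruct (rep_q (special_data E d) g (ex_intro _ (S n) Hg)) as [x Hx].
    exists x. split; cbn [fst snd].
    + apply (HTx x g Hx). intros [i b]. destruct (HY (i, tr b)) as (H & _).
      revert H. apply tru_ext. intros v Hv. cbn [fst snd]. unfold upd.
      destruct (v =? y); auto. apply Henv; auto. intros m Hm. rewrite Htr by lia. reflexivity.
    + intros t Ht. rewrite (HTx x g Hx). intros Hall.
      assert (Hpt : exists i b, (tail d i -> b 0 <= n) /\ Ext E (pt d i) (env i b) y (s, Some t)).
      { destruct (Hts t Ht) as [(r & Hr & Hrt)|[Hex Hxx]].
        - specialize (Hn r Hr). rewrite HT in Hn. apply not_all_ex_not in Hn.
          destruct Hn as [[i b] Hn]. cbn [fst] in Hn. rewrite Hrt in Hn; auto.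
          apply NNPP in Hn.
          (* A point too far out in the tail is replaced by the constant sequence [n]; the
             parameters equal [e] at both. *)
          destruct (classic (tail d i /\ n <= b 0)) as [[Hi Hb]|Hib].
          + exists i, (fun _ => n). split; auto. revert Hn. apply Ext_ext.
            intros v Hv _. pose proof (proj2 (HV v (HVp t v Ht Hv)) i) as Hl. unfold env.
            rewrite !Hl; auto.
          + exists i, b. split; [|exact Hn]. intros Hi.
            destruct (Nat.le_gt_cases n (b 0)); [exfalso; auto|lia].
        - destruct (tail_ex E d Hex) as [i Hi]. exists i, (fun _ => n). split; auto.
          apply Hxx; auto; [apply tail_zr; auto|]. intros v Hv. unfold env.
          apply (proj2 (HV v (HVx v Hv))); auto. }
      destruct Hpt as (i & b & Hb0 & Hext).
      destruct (In_nth_error ts t Ht) as [j Hj].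
      (* Setting coordinate [n] to the position [j] of [t] leaves the parameters unchanged and
         directs the witness to refute [t]. *)
      set (b' := fun m => if m =? n then j else b m).
      assert (Hbb : forall m, m < n -> b m = b' m).
      { intros m Hm. unfold b'. rewrite (proj2 (Nat.eqb_neq m n)) by lia. auto. }
      destruct (HY (i, tr b')) as (_ & _ & Hfail). cbn [fst snd] in Hfail.
      rewrite !Htr in Hfail by lia.
      unfold b' at 2 in Hfail. rewrite Nat.eqb_refl in Hfail.
      apply (fun H => Hfail H t Hj).
      * intros Hi. unfold b'. change (0 =? n) with false. cbn iota. specialize (Hb0 Hi). lia.
      * revert Hext. apply Ext_ext. intros v Hv _. apply Henv; [|apply (HVp t); auto].
        intros m Hm. rewrite Htr by lia. auto.
      * generalize (Hall (i, b')). apply tru_ext. intros v Hv. cbn [fst snd]. unfold upd.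
        destruct (v =? y); auto. apply (Henv i (tr b') b'); [|apply (HVt t); auto].
        intros m Hm. rewrite Htr by lia. auto.
Qed.

(** Each pair of distinct elements supplies an existentially closed chain separating it, and [M] is
    mapped to functions constant in the Baire coordinate. Over a tail index [M] is sent to [e], a
    homomorphism since [0 = e] there, so the support condition is met. *)
Lemma special_extension E M : semilinear E -> elimination E -> inVR E M ->
  exists (d : ecfam E) (h : M -> special E d), embedding M (special E d) h.
Proof.
  intros Hsl Hel HM.
  set (P := exists C, inVcR E C /\ nontrivial C /\ zr C = un C).
  (* The summand [{_ : unit | P}] turns the proposition [P] into a type inhabited exactly when [P]
     holds. *)
  set (I := ({q : M * M | fst q <> snd q} + {_ : unit | P})%type).
  assert (HD : forall i : I, exists D : Rstr, exists pi : M -> D, ec E D /\ Rhom M D pi /\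
    match i with
    | inl q => pi (fst (proj1_sig q)) <> pi (snd (proj1_sig q))
    | inr _ => zr D = un D /\ forall a, pi a = un D
    end).
  { intros [[[a b] Hab]|[_ (C & HC & Hn & Hz)]]; cbn [fst snd proj1_sig] in *.
    - destruct (separating_chain E M a b HM Hab) as (C & h & HC & Hh & Hne).
      assert (Hn : nontrivial C).
      { apply NNPP. intros Hno. apply Hne.
        apply (le_dif C (proj1 (proj1 (proj1 HC)))).
        apply NNPP. intros Hd. apply Hno. eexists; exact Hd. }
      destruct (ec_extension E Hsl Hel C HC Hn) as (D & e & HD & He).
      destruct (embedding_Rhom _ _ _ He) as (E1 & E2 & E3). destruct Hh as (H1 & H2 & H3).
      exists D, (fun a => e (h a)). split; auto. split.
      + split; [|split]; [intros; rewrite H1, E1; auto|congruence|congruence].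
      + intros Hc. apply Hne. apply He. exact Hc.
    - destruct (ec_extension E Hsl Hel C HC Hn) as (D & e & HD & He).
      destruct (embedding_Rhom _ _ _ He) as (E1 & E2 & E3).
      exists D, (fun _ => un D). split; auto. split; [|split; [congruence|auto]].
      split; [|split; [auto|congruence]]. intros b _ _. symmetry. apply (chain_ap_un E). apply HD. }
  destruct (dep_choice _ _ _ HD) as [D HD']. destruct (dep_choice _ _ _ HD') as [pi Hpi].
  clear HD HD'.
  set (tl := fun i : I => match i with inl _ => False | inr _ => True end).
  assert (Htl : forall i, tl i -> zr (D i) = un (D i) /\ forall a, pi i a = un (D i)).
  { intros [i|i] Hi; [destruct Hi|]. apply (Hpi (inr i)). }
  set (d := Build_ecfam E I D tl (fun i => proj1 (Hpi i)) (fun i Hi => proj1 (Htl i Hi))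
    (fun HP => ex_intro _ (inr (exist _ tt HP)) Logic.I)).
  assert (Hr : forall a, exists x, rep (special_data E d) (fun q => pi (fst q) a) x).
  { intros a. apply rep_q. exists 0. split; auto. intros i b Hi _. apply Htl; auto. }
  destruct (dep_choice _ _ _ Hr) as [h Hh]. exists d, h.
  apply Rhom_embedding; [split; [|split]|].
  - intros b x y. apply (rep_eq (special_data E d) _ _ _ _ (Hh _) (rep_op _ b _ _ _ _ (Hh x) (Hh y))).
    intros q. apply (Hpi (fst q)).
  - apply (rep_eq (special_data E d) _ _ _ _ (Hh _) (rep_un _)). intros q. apply (Hpi (fst q)).
  - apply (rep_eq (special_data E d) _ _ _ _ (Hh _) (rep_zr _)). intros q. apply (Hpi (fst q)).
  - intros a b Hab. apply NNPP. intros Hne.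
    apply (rep_eq (special_data E d) _ _ _ _ (Hh _) (Hh _)) in Hab.
    specialize (Hab (inl (exist _ (a, b) Hne), fun _ => 0)). simpl in Hab.
    apply (Hpi (inl (exist _ (a, b) Hne))). exact Hab.
Qed.

(** * Quantifier elimination *)

Section QE.
Context (E : term -> term -> Prop) (Hsl : semilinear E) (Hel : elimination E).

(** [L] is chosen before [d]: a normal form common to all families is what the common theory can
    express. *)
Definition dnf (P : forall d : ecfam E, (nat -> special E d) -> Prop) : Prop :=
  exists L, forall d rho, P d rho <-> exists c, In c L /\ csat (special E d) rho c.

Lemma dnf_tru t : dnf (fun d rho => tru (special E d) rho t).
Proof.
  exists [(t, [])]. intros d rho. split.
  - intros H. exists (t, []). split; [simpl; auto|]. split; [exact H|intros u []].
  - intros (c & [<-|[]] & H & _). exact H.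
Qed.

Lemma dnf_or P Q : dnf P -> dnf Q -> dnf (fun d rho => P d rho \/ Q d rho).
Proof.
  intros [L H] [L' H']. exists (L ++ L'). intros d rho. rewrite H, H'. split.
  - intros [(c & Hc & S)|(c & Hc & S)]; exists c; auto using in_or_app.
  - intros (c & Hc & S). apply in_app_or in Hc. destruct Hc; eauto.
Qed.

Lemma dnf_and P Q : dnf P -> dnf Q -> dnf (fun d rho => P d rho /\ Q d rho).
Proof.
  intros [L H] [L' H'].
  exists (flat_map (fun c => map (fun c' => (rmeet (fst c) (fst c'), snd c ++ snd c')) L') L).
  assert (Hc : forall d rho c c', csat (special E d) rho (rmeet (fst c) (fst c'), snd c ++ snd c') <->
    csat (special E d) rho c /\ csat (special E d) rho c').
  { intros d rho c c'. unfold csat. cbn [fst snd]. rewrite special_meet. split.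
    - intros [[H1 H2] H3]. repeat split; auto; intros t Ht; apply H3; apply in_or_app; auto.
    - intros [[H1 H2] [H3 H4]]. repeat split; auto. intros t Ht. apply in_app_or in Ht.
      destruct Ht; auto. }
  intros d rho. rewrite H, H'. split.
  - intros [(c & Ic & S) (c' & Ic' & S')].
    exists (rmeet (fst c) (fst c'), snd c ++ snd c'). split.
    + apply in_flat_map. exists c. split; auto. apply in_map_iff. exists c'. auto.
    + apply Hc. auto.
  - intros (c0 & Ic & S). apply in_flat_map in Ic. destruct Ic as (c & Ic & Ic').
    apply in_map_iff in Ic'. destruct Ic' as (c' & <- & Ic'). apply Hc in S.
    destruct S. split; eauto.
Qed.

Lemma dnf_iff P Q : (forall d rho, P d rho <-> Q d rho) -> dnf P -> dnf Q.
Proof. intros H [L HL]. exists L. intros d rho. rewrite <- H. auto. Qed.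

Lemma dnf_not P : dnf P -> dnf (fun d rho => ~ P d rho).
Proof.
  intros [L HL].
  apply (dnf_iff (fun d rho => ~ exists c, In c L /\ csat (special E d) rho c));
    [intros; rewrite HL; tauto|]. clear HL.
  induction L as [|c L IH].
  - exists [(re, [])]. intros d rho. split.
    + intros _. exists (re, []). split; [simpl; auto|]. split; [apply special_re|intros t []].
    + intros _ (c & [] & _).
  - apply (dnf_iff (fun d rho => ~ csat (special E d) rho c /\
      ~ exists c, In c L /\ csat (special E d) rho c)).
    + intros d rho. split.
      * intros [H1 H2] (c' & [<-|Hc] & H); eauto.
      * intros H. split; [intros H1|intros (c' & Hc & H1)]; apply H;
          [exists c|exists c']; simpl; auto.
    + apply dnf_and; auto. clear IH.
      exists ((re, [fst c]) :: map (fun t => (t, [])) (snd c)). intros d rho. split.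
      * intros H. destruct (classic (tru (special E d) rho (fst c))) as [Hs|Hs].
        -- assert (Ht : exists t, In t (snd c) /\ tru (special E d) rho t).
           { apply NNPP. intros Hn. apply H. split; auto. intros t Ht Hc. apply Hn. eauto. }
           destruct Ht as (t & Ht & H'). exists (t, []). split.
           ++ right. apply in_map_iff. eauto.
           ++ split; [exact H'|intros u []].
        -- exists (re, [fst c]). split; [left; auto|]. split; [apply special_re|].
           intros u [<-|[]]. auto.
      * intros (c' & [<-|Hc'] & H1 & H2) [H3 H4].
        -- apply (H2 (fst c)); simpl; auto.
        -- apply in_map_iff in Hc'. destruct Hc' as (t & <- & Ht). apply (H4 t); auto.
Qed.

Lemma dnf_ex P y : dnf P -> dnf (fun d rho => exists a, P d (upd rho y a)).
Proof.
  intros [L HL].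
  apply (dnf_iff (fun d rho => exists c, In c L /\ exists a, csat (special E d) (upd rho y a) c)).
  { intros d rho. split.
    - intros (c & Hc & a & H). exists a. apply HL. eauto.
    - intros (a & H). apply HL in H. destruct H as (c & Hc & H). eauto. }
  clear HL. induction L as [|c L IH].
  - exists []. intros d rho. split; intros (c & [] & _).
  - apply (dnf_iff (fun d rho => (exists a, csat (special E d) (upd rho y a) c) \/
      exists c, In c L /\ exists a, csat (special E d) (upd rho y a) c)).
    + intros d rho. split.
      * intros [H|(c' & Hc & H)]; [exists c|exists c']; simpl; auto.
      * intros (c' & [<-|Hc] & H); eauto.
    + apply dnf_or; auto. destruct (special_elim E Hsl Hel y c) as [c' Hc'].
      exists [c']. intros d rho. rewrite Hc'. split.
      * intros H. exists c'. simpl; auto.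
      * intros (c0 & [<-|[]] & H). exact H.
Qed.

Lemma dnf_holds p : dnf (fun d rho => holds (special E d) (noconst _) rho p).
Proof.
  induction p; cbn [holds].
  - apply (dnf_iff (fun d rho => tru (special E d) rho (rdif s t))).
    + intros d rho. apply special_dif.
    + apply dnf_tru.
  - exists []. intros d rho. split; [tauto|intros (c & [] & _)].
  - apply dnf_not. auto.
  - apply (dnf_and (fun d rho => holds (special E d) (noconst _) rho p1)); auto.
  - apply (dnf_or (fun d rho => holds (special E d) (noconst _) rho p1)); auto.
  - apply (dnf_iff (fun d rho => ~ holds (special E d) (noconst _) rho p1 \/
      holds (special E d) (noconst _) rho p2)).
    + intros d rho. tauto.
    + apply dnf_or; auto. apply dnf_not; auto.
  - apply (dnf_iff (fun d rho => ~ exists a, ~ holds (special E d) (noconst _) (upd rho n a) p)).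
    + intros d rho. split.
      * intros H a. apply NNPP. intros Hn. apply H. eauto.
      * intros H [a Ha]. auto.
    + apply dnf_not. apply (dnf_ex (fun d rho => ~ holds (special E d) (noconst _) rho p)).
      apply dnf_not. auto.
  - apply (dnf_ex (fun d rho => holds (special E d) (noconst _) rho p)). auto.
Qed.

Definition tru_fm (t : rtm Empty_set) : fm Empty_set := fEq (rmeet re t) re.

Definition clause_fm (c : rtm Empty_set * list (rtm Empty_set)) : fm Empty_set :=
  fAnd (tru_fm (fst c)) (fold_right fAnd (fNot fBot) (map (fun t => fNot (tru_fm t)) (snd c))).

Lemma holds_clause_fm (N : Rstr) rho c : holds N (noconst N) rho (clause_fm c) <-> csat N rho c.
Proof.
  destruct c as [s ts]. unfold clause_fm, csat. cbn [holds fst snd].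
  assert (H : holds N (noconst N) rho (fold_right fAnd (fNot fBot) (map (fun t => fNot (tru_fm t)) ts))
    <-> forall t, In t ts -> ~ tru N rho t).
  { induction ts as [|t ts IH]; cbn [map fold_right holds].
    - split; [intros _ t []|intros _ []].
    - rewrite IH. split.
      + intros [Ht Hts] u [<-|Hu]; [exact Ht|auto].
      + intros H. split; [|intros u Hu; apply H; right; exact Hu].
        apply (H t). left. reflexivity. }
  rewrite H. reflexivity.
Qed.

Lemma qfree_clause_fm c : qfree (clause_fm c).
Proof.
  split; [exact Logic.I|]. induction (snd c); simpl; auto.
Qed.

Lemma special_qe p : exists q, qfree q /\ forall d rho,
  holds (special E d) (noconst _) rho p <-> holds (special E d) (noconst _) rho q.
Proof.
  destruct (dnf_holds p) as [L HL]. exists (fold_right fOr fBot (map clause_fm L)). split.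
  - clear HL. induction L; simpl; auto. split; auto. apply qfree_clause_fm.
  - intros d rho. rewrite HL. clear HL. induction L as [|c L IH]; cbn [map fold_right holds].
    + split; [intros (c & [] & _)|tauto].
    + rewrite <- IH, holds_clause_fm. split.
      * intros (c' & [<-|Hc] & H); eauto.
      * intros [H|(c' & Hc & H)]; [exists c|exists c']; simpl; auto.
Qed.

End QE.

(** * The model completion *)

Lemma upd_same X (rho : nat -> X) n : upd rho n (rho n) = rho.
Proof.
  apply functional_extensionality. intros m. unfold upd.
  destruct (Nat.eqb_spec m n); subst; auto.
Qed.

Definition closure (p : fm Empty_set) : fm Empty_set := fold_right fAll p (fv p).

Lemma sat_closure M p : sat M (closure p) <-> sat M p.
Proof.
  unfold closure. induction (fv p) as [|n l IH]; cbn [fold_right]; [tauto|].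
  rewrite <- IH. split.
  - intros H rho. specialize (H rho (rho n)). rewrite upd_same in H. exact H.
  - intros H rho a. apply H.
Qed.

Lemma sentence_closure p : sentence (closure p).
Proof.
  assert (H : forall l n, In n (fv (fold_right fAll p l)) -> In n (fv p) /\ ~ In n l).
  { induction l as [|m l IH]; simpl; intros n Hn; [tauto|].
    apply in_remove in Hn. destruct Hn as [Hn Hm]. apply IH in Hn.
    split; [tauto|]. intros [->|Hl]; tauto. }
  unfold sentence. destruct (fv (closure p)) as [|n l] eqn:Ec; auto.
  assert (Hn : In n (fv (closure p))) by (rewrite Ec; simpl; auto).
  apply H in Hn. tauto.
Qed.

Lemma holds_emb C (M N : Rstr) h (c : C -> M) (c' : C -> N) q :
  qfree q -> embedding M N h -> (forall k, h (c k) = c' k) ->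
  forall rho rho', (forall n, In n (fv q) -> h (rho n) = rho' n) ->
  (holds M c rho q <-> holds N c' rho' q).
Proof.
  intros Hq Hh Hc rho rho'. pose proof (embedding_Rhom _ _ _ Hh) as Hr.
  induction q; simpl in *; intros Hv; try tauto.
  - rewrite <- (reval_hom C M N h c c' rho rho' s), <- (reval_hom C M N h c c' rho rho' t);
      auto using in_or_app.
    split; [congruence|]. apply Hh.
  - destruct Hq. rewrite IHq1, IHq2; auto using in_or_app; tauto.
  - destruct Hq. rewrite IHq1, IHq2; auto using in_or_app; tauto.
  - destruct Hq. rewrite IHq1, IHq2; auto using in_or_app; tauto.
Qed.

Lemma holds_ext C (N : Rstr) (c : C -> N) p : forall rho rho',
  (forall n, In n (fv p) -> rho n = rho' n) -> (holds N c rho p <-> holds N c rho' p).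
Proof.
  induction p; simpl; intros rho rho' Hv; try tauto.
  - rewrite (reval_ext C N c c rho rho' s), (reval_ext C N c c rho rho' t);
      auto using in_or_app; tauto.
  - rewrite (IHp rho rho'); auto. tauto.
  - rewrite (IHp1 rho rho'), (IHp2 rho rho'); auto using in_or_app; tauto.
  - rewrite (IHp1 rho rho'), (IHp2 rho rho'); auto using in_or_app; tauto.
  - rewrite (IHp1 rho rho'), (IHp2 rho rho'); auto using in_or_app; tauto.
  - assert (H : forall a, holds N c (upd rho n a) p <-> holds N c (upd rho' n a) p).
    { intros a. apply IHp. intros m Hm. unfold upd.
      destruct (Nat.eqb_spec m n); auto. apply Hv. apply in_in_remove; auto. }
    split; intros H' a; apply H; auto.
  - assert (H : forall a, holds N c (upd rho n a) p <-> holds N c (upd rho' n a) p).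
    { intros a. apply IHp. intros m Hm. unfold upd.
      destruct (Nat.eqb_spec m n); auto. apply Hv. apply in_in_remove; auto. }
    split; intros [a H']; exists a; apply H; auto.
Qed.

Lemma universal_down (M N : Rstr) h p : embedding M N h -> universal p ->
  forall rho, holds N (noconst N) (fun n => h (rho n)) p -> holds M (noconst M) rho p.
Proof.
  intros Hh Hu.
  assert (Hq : qfree p -> forall rho, holds N (noconst N) (fun n => h (rho n)) p ->
    holds M (noconst M) rho p).
  { intros Hq rho H. apply (holds_emb _ M N h (noconst M) (noconst N) p Hq Hh) with (rho := rho) in H;
      auto. intros []. }
  induction p; auto. intros rho H a. apply IHp; auto.
  - intros Hq' r. apply (holds_emb _ M N h (noconst M) (noconst N) p Hq' Hh); auto. intros [].
  - specialize (H (h a)). revert H. apply holds_ext. intros m _. unfold upd.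
    destruct (m =? n); auto.
Qed.

(** Constants become odd variables and old variables even ones, so that quantifier elimination,
    proved for the pure language, applies to formulas with names for elements of a model. *)
Fixpoint abs_tm {C} (k : C -> nat) (t : rtm C) : rtm Empty_set :=
  match t with
  | rvar n => rvar (2 * n)
  | rcst c => rvar (S (2 * k c))
  | rmeet s u => rmeet (abs_tm k s) (abs_tm k u)
  | rjoin s u => rjoin (abs_tm k s) (abs_tm k u)
  | rmul s u => rmul (abs_tm k s) (abs_tm k u)
  | rld s u => rld (abs_tm k s) (abs_tm k u)
  | rrd s u => rrd (abs_tm k s) (abs_tm k u)
  | rrh s u => rrh (abs_tm k s) (abs_tm k u)
  | re => re
  | rzero => rzero
  end.

Fixpoint abs_fm {C} (k : C -> nat) (p : fm C) : fm Empty_set :=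
  match p with
  | fEq s t => fEq (abs_tm k s) (abs_tm k t)
  | fBot => fBot
  | fNot q => fNot (abs_fm k q)
  | fAnd q r => fAnd (abs_fm k q) (abs_fm k r)
  | fOr q r => fOr (abs_fm k q) (abs_fm k r)
  | fImp q r => fImp (abs_fm k q) (abs_fm k r)
  | fAll n q => fAll (2 * n) (abs_fm k q)
  | fEx n q => fEx (2 * n) (abs_fm k q)
  end.

Fixpoint tm_csts {C} (t : rtm C) : list C :=
  match t with
  | rcst c => [c]
  | rmeet s u | rjoin s u | rmul s u | rld s u | rrd s u | rrh s u => tm_csts s ++ tm_csts u
  | _ => []
  end.

Fixpoint fm_csts {C} (p : fm C) : list C :=
  match p with
  | fEq s t => tm_csts s ++ tm_csts t
  | fBot => []
  | fNot q | fAll _ q | fEx _ q => fm_csts q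
  | fAnd q r | fOr q r | fImp q r => fm_csts q ++ fm_csts r
  end.

Lemma reval_abs C (N : Rstr) (c : C -> N) k rho sg (t : rtm C) :
  (forall n, sg (2 * n) = rho n) -> (forall x, In x (tm_csts t) -> sg (S (2 * k x)) = c x) ->
  reval N (noconst N) sg (abs_tm k t) = reval N c rho t.
Proof.
  intros Hv. induction t; cbn [abs_tm reval tm_csts]; intros Hc; auto;
    try (rewrite IHt1, IHt2 by auto using in_or_app; auto).
  apply Hc. simpl; auto.
Qed.

Lemma holds_abs C (N : Rstr) (c : C -> N) k (p : fm C) : forall rho sg,
  (forall n, sg (2 * n) = rho n) -> (forall x, In x (fm_csts p) -> sg (S (2 * k x)) = c x) ->
  (holds N (noconst N) sg (abs_fm k p) <-> holds N c rho p).
Proof.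
  assert (Hupd : forall (rho sg : nat -> N) n (a : N), (forall m, sg (2 * m) = rho m) ->
    forall m, upd sg (2 * n) a (2 * m) = upd rho n a m).
  { intros rho sg n a Hv m. unfold upd.
    destruct (Nat.eqb_spec m n) as [->|Hne]; [rewrite Nat.eqb_refl; auto|].
    rewrite (proj2 (Nat.eqb_neq _ _)) by lia. auto. }
  assert (Hupd' : forall (sg : nat -> N) n (a : N) m, upd sg (2 * n) a (S (2 * m)) = sg (S (2 * m))).
  { intros sg n a m. unfold upd. rewrite (proj2 (Nat.eqb_neq _ _)) by lia. auto. }
  induction p; cbn [abs_fm holds fm_csts]; intros rho sg Hv Hc; try tauto.
  - rewrite !(reval_abs C N c k rho sg) by auto using in_or_app. tauto.
  - rewrite (IHp rho sg); auto. tauto.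
  - rewrite (IHp1 rho sg), (IHp2 rho sg); auto using in_or_app. tauto.
  - rewrite (IHp1 rho sg), (IHp2 rho sg); auto using in_or_app. tauto.
  - rewrite (IHp1 rho sg), (IHp2 rho sg); auto using in_or_app. tauto.
  - assert (H : forall a, holds N (noconst N) (upd sg (2 * n) a) (abs_fm k p) <->
      holds N c (upd rho n a) p).
    { intros a. apply IHp; [apply Hupd; auto|]. intros x Hx. rewrite Hupd'; auto. }
    split; intros H' a; apply H; auto.
  - assert (H : forall a, holds N (noconst N) (upd sg (2 * n) a) (abs_fm k p) <->
      holds N c (upd rho n a) p).
    { intros a. apply IHp; [apply Hupd; auto|]. intros x Hx. rewrite Hupd'; auto. }
    split; intros [a H']; exists a; apply H; auto.
Qed.

Lemma diagram_embedding T M N c : ModelsTD T M N c -> embedding M N c.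
Proof.
  intros [_ HD].
  assert (H : forall s t : rtm M, rvars s = [] -> rvars t = [] ->
    (reval M (fun a => a) (fun _ => un M) s = reval M (fun a => a) (fun _ => un M) t <->
     reval N c (fun _ => un N) s = reval N c (fun _ => un N) t)).
  { intros s t Hs Ht.
    assert (He : forall rho, reval M (fun a => a) rho s = reval M (fun a => a) (fun _ => un M) s /\
      reval M (fun a => a) rho t = reval M (fun a => a) (fun _ => un M) t).
    { intros rho. split; apply reval_ext; auto; intros n Hn;
        [rewrite Hs in Hn|rewrite Ht in Hn]; destruct Hn. }
    assert (Hst : sentence (fEq s t)) by (unfold sentence; simpl; rewrite Hs, Ht; auto).
    split.
    - intros Heq. apply (HD (fEq s t)). split; auto. split; [eauto|].
      intros rho. simpl. destruct (He rho). congruence.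
    - intros Heq. apply NNPP. intros Hne.
      refine (HD (fNot (fEq s t)) _ (fun _ => un N) Heq). split; auto. split; [eauto|].
      intros rho. simpl. destruct (He rho). congruence. }
  apply Rhom_embedding.
  - split; [|split].
    + intros b x y. symmetry.
      (* The variable list of [rbin b] computes only when [b] is a constructor, hence the
         [match]. *)
      pose proof (proj1 (H (rbin b (rcst x) (rcst y)) (rcst (ap b M x y))
        (match b with brh => eq_refl | _ => eq_refl end) eq_refl)) as Hb.
      rewrite !reval_rbin in Hb. apply Hb. reflexivity.
    + symmetry. apply (proj1 (H re (rcst (un M)) eq_refl eq_refl)). reflexivity.
    + symmetry. apply (proj1 (H rzero (rcst (zr M)) eq_refl eq_refl)). reflexivity.
  - intros a b Hab. apply (proj2 (H (rcst a) (rcst b) eq_refl eq_refl)). exact Hab.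
Qed.

Lemma Models_ThVR E M : Models (ThVR E) M -> inVR E M.
Proof.
  intros HM l r Hlr rho.
  assert (H : sat M (closure (fEq l r))).
  { apply HM. split; [apply sentence_closure|]. intros M' HM'. apply sat_closure.
    intros rho'. apply HM'. exact Hlr. }
  apply (proj1 (sat_closure M _) H).
Qed.

Definition special_theory E : theory :=
  fun p => sentence p /\ forall d : ecfam E, sat (special E d) p.

Lemma special_Models E d : Models (special_theory E) (special E d).
Proof. intros p [_ Hp]. apply Hp. Qed.

(** The equivalence with the quantifier-free form is uniform in [d], so its closure belongs to the
    theory and holds in all models, special or not. *)
Lemma special_theory_qe E : semilinear E -> elimination E ->
  forall p, exists q, qfree q /\ forall N, Models (special_theory E) N -> forall rho,
    holds N (noconst N) rho p <-> holds N (noconst N) rho q.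
Proof.
  intros Hsl Hel p. destruct (special_qe E Hsl Hel p) as (q & Hq & Hpq).
  exists q. split; auto. intros N HN.
  assert (H : sat N (closure (fAnd (fImp p q) (fImp q p)))).
  { apply HN. split; [apply sentence_closure|]. intros d. apply sat_closure.
    intros rho. exact (Hpq d rho). }
  rewrite sat_closure in H. exact H.
Qed.

(** In every model of the theory and the diagram, a sentence over [M] amounts to one quantifier-free
    condition on elements of [M], which [M] itself decides. Consistency comes from
    [special_extension]. *)
Lemma special_theory_complete E M : semilinear E -> elimination E -> inVR E M ->
  completeTD (special_theory E) M.
Proof.
  intros Hsl Hel HM. split.
  - destruct (special_extension E M Hsl Hel HM) as (d & h & Hh).
    exists (special E d), h. split; [apply special_Models|].
    intros p (Hs & Hat & Hp) rho.
    assert (Hq : qfree p) by (destruct Hat as (s & t & [->| ->]); simpl; auto).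
    apply (holds_emb M M (special E d) h (fun a => a) h p Hq Hh) with (rho := fun _ => un M); auto.
    intros n Hn. rewrite Hs in Hn. destruct Hn.
  - intros p Hp. set (l := fm_csts p). set (k := pos (un M) l).
    destruct (special_theory_qe E Hsl Hel (abs_fm k p)) as (q & Hq & Hpq).
    (* Odd variables take the elements named by the constants of [p]; even ones get a dummy value,
       [p] being a sentence. *)
    set (mu := fun m => if Nat.even m then un M else nth (Nat.div2 m) l (un M)).
    assert (H : forall N c, ModelsTD (special_theory E) M N c -> forall rho,
      holds N c rho p <-> holds M (noconst M) mu q).
    { intros N c HN rho. pose proof (diagram_embedding _ _ _ _ HN) as Hc.
      rewrite (holds_ext M N c p rho (fun _ => c (un M)))
        by (intros n Hn; rewrite Hp in Hn; destruct Hn).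
      rewrite <- (holds_abs M N c k p (fun _ => c (un M)) (fun n => c (mu n))).
      - rewrite (Hpq N (proj1 HN)). symmetry.
        apply (holds_emb Empty_set M N c); auto. intros [].
      - intros n. unfold mu. rewrite Nat.even_even. auto.
      - intros x Hx. unfold mu. replace (S (2 * k x)) with (2 * k x + 1) by lia.
        rewrite Nat.even_odd, Nat.add_1_r, Nat.div2_succ_double. f_equal. apply nth_pos. exact Hx. }
    destruct (classic (holds M (noconst M) mu q)) as [Hmu|Hmu].
    + left. intros N c HN rho. apply (H N c HN). exact Hmu.
    + right. intros N c HN rho Hc. apply Hmu. apply (H N c HN rho). exact Hc.
Qed.

Theorem theorem7p6 (E : term -> term -> Prop) :
  semilinear E ->
  (forall (xs : list nat) (y : nat), ~ In y xs ->
   forall (s : term) (t : option term),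
     term_in (y :: xs) s -> oterm_in (y :: xs) t ->
     exists K : list (term * option term),
       K <> [] /\
       (forall k, In k K -> term_in xs (fst k) /\ oterm_in xs (snd k)) /\
       forall zs : list nat, (forall z, In z zs -> ~ In z (y :: xs)) ->
       forall u v : term, term_in (xs ++ zs) u -> term_in (xs ++ zs) v ->
         (conseq E [tmeet u s] (ojoin t v) <->
          forall k, In k K -> conseq E [tmeet u (fst k)] (ojoin (snd k) v))) ->
  has_model_completion (ThVR E).
Proof.
  intros Hsl Hel. change (elimination E) in Hel.
  exists (special_theory E). split; [intros p Hp; apply Hp|]. split; [|split].
  (* Embeddings preserve and reflect quantifier-free formulas, so elimination yields model
     completeness. *)
  - intros M N h HM HN Hh p rho.
    destruct (special_theory_qe E Hsl Hel p) as (q & Hq & Hpq).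
    rewrite (Hpq M HM), (Hpq N HN). apply (holds_emb Empty_set M N h); auto. intros [].
  - intros p _ Hu. split.
    (* Special models lie in [V_|>], so their theory extends [ThVR E]. *)
    + intros H N HN. apply H. intros r [Hr1 Hr2]. apply HN. split; auto.
      intros d. apply Hr2. apply special_inVR.
    (* Every member of [V_|>] embeds in a special model, and universal formulas pass down along
       embeddings. *)
    + intros H M HM rho. apply Models_ThVR in HM.
      destruct (special_extension E M Hsl Hel HM) as (d & h & Hh).
      apply (universal_down M (special E d) h p Hh Hu). apply H. apply special_Models.
  - intros M HM. apply special_theory_complete; auto. apply Models_ThVR. exact HM.
Qed.
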